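(* Let $n\geq 2$ be an integer, and let $G$ be a bipartite transposition-like graph of rank $n$ with partite sets $V_1$ and $V_2$, formed by a given welding process. Assume that every rank $1$ transposition-like graph from which $G$ is built up in this welding process is either a single vertex or has an even number of vertices. Then for every choice of $(n-1)$-subsets $S=\{s_1,\dotsc,s_{n-1}\}\subseteq V_1$ and $T=\{t_1,\dotsc,t_{n-1}\}\subseteq V_2$ (with arbitrary labelings of their elements), $G$ admits an $(n-1)$-PDPC with respect to $S$ and $T$.
   Context: Graphs are finite, simple, undirected and nonempty. PDPC: For disjoint $k$-subsets $S=\{s_1,\dotsc,s_k\}$ and $T=\{t_1,\dotsc,t_k\}$ of $V(G)$, a paired $k$-to-$k$ disjoint path cover ($k$-PDPC) of $G$ is a collection of path subgraphs $P_1,\dotsc,P_k$ of $G$ such that $V(P_1),\dotsc,V(P_k)$ form a partition of $V(G)$ and $P_i$ has $s_i$ and $t_i$ as its endpoints for each $i\in\{1,\dotsc,k\}$. Hamiltonian-connected: for every two distinct vertices $s,t$ there is a Hamiltonian path with endpoints $s$ and $t$; the one-vertex graph counts as Hamiltonian-connected. Hamiltonian-laceable: a bipartite graph with partite sets $V_1,V_2$ such that for every two distinct vertices $s,t$ with $|\{s,t\}\cap V_1|-|\{s,t\}\cap V_2|=2(|V_1|-|V_2|)$ (a ''balanced'' pair) there is a Hamiltonian path with endpoints $s$ and $t$; it is understood that at least one balanced pair exists. Weld: if $G_1,\dotsc,G_\ell$ are graphs with the same number of vertices, a graph $G$ is a weld of $G_1,\dotsc,G_\ell$ if $V(G)$ is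 the disjoint union of the $V(G_i)$, the subgraph of $G$ induced on $V(G_i)$ is $G_i$ for each $i$, and for all $1\leq i<j\leq \ell$ the edges of $G$ between $V(G_i)$ and $V(G_j)$ form a perfect matching between $V(G_i)$ and $V(G_j)$ (so each vertex of $G_i$ has exactly one neighbor in $G_j$). Transposition-like graphs, defined recursively: a transposition-like graph of rank $1$ is a Hamiltonian-connected or Hamiltonian-laceable graph. For $n\geq 2$, a transposition-like graph of rank $n$ is a weld of $G_1,\dotsc,G_\ell$ for some $\ell\geq n$, where each $G_i$ is a transposition-like graph of rank $n-1$ and all $G_i$ have the same number of vertices. The welding process is the recursive choice of the welds: the rank $1$ graphs that $G$ is built up from are obtained by decomposing $G$ into its rank $n-1$ pieces $G_1,\dotsc,G_\ell$, each of these into its rank $n-2$ pieces, and so on down to rank $1$ pieces. *)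

(* Defs.v *)
From HB Require Import structures.
From mathcomp Require Import all_boot all_order all_algebra.
Set Implicit Arguments.
Unset Strict Implicit.
Unset Printing Implicit Defensive.

(* A graph is a finType V with a symmetric irreflexive e : rel V.  For        *)
(* A : {set V}, the definitions below that take e and A are about the induced *)
(* subgraph G[A]; a weld contains its pieces as induced subgraphs, so all the *)
(* pieces of a welding process are of this form.                              *)

(* p lists the vertices of a path after its first vertex s: the vertex set of *)
(* the path is that of s :: p.                                                *)
Definition path_between (V : finType) (e : rel V) (s t : V) (p : seq V) : Prop :=
  [/\ path e s p, last s p = t & uniq (s :: p)].

Definition has_hamiltonian_path (V : finType) (e : rel V) (A : {set V})
    (s t : V) : Prop :=
  exists p : seq V, path_between e s t p /\ [set:: s :: p] = A.

Definition hamiltonian_connected (V : finType) (e : rel V) (A : {set V}) : Prop :=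
  A != set0 /\
  (forall s t : V, s \in A -> t \in A -> s != t -> has_hamiltonian_path e A s t).

Definition bipartition (V : finType) (e : rel V) (A V1 V2 : {set V}) : Prop :=
  [/\ V1 :|: V2 = A, [disjoint V1 & V2],
      (forall x y : V, x \in V1 -> y \in V1 -> ~~ e x y)
    & (forall x y : V, x \in V2 -> y \in V2 -> ~~ e x y)].

Definition balanced_pair (V : finType) (V1 V2 : {set V}) (s t : V) : Prop :=
  (#|[set s; t] :&: V1|%:Z - #|[set s; t] :&: V2|%:Z
    = 2 * (#|V1|%:Z - #|V2|%:Z))%R.

Definition hamiltonian_laceable (V : finType) (e : rel V) (A : {set V}) : Prop :=
  exists V1 V2 : {set V},
    [/\ bipartition e A V1 V2,
        (exists s t : V, [/\ s \in A, t \in A, s != t & balanced_pair V1 V2 s t])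
      & (forall s t : V, s \in A -> t \in A -> s != t ->
           balanced_pair V1 V2 s t -> has_hamiltonian_path e A s t)].

Definition disjoint_union (V : finType) (l : nat) (B : 'I_l -> {set V})
    (A : {set V}) : Prop :=
  (forall i j : 'I_l, i != j -> [disjoint B i & B j]) /\ \bigcup_i B i = A.

Definition weld (V : finType) (e : rel V) (A : {set V}) (l : nat)
    (B : 'I_l -> {set V}) : Prop :=
  [/\ disjoint_union B A,
      (forall i j : 'I_l, #|B i| = #|B j|)
    & (forall i j : 'I_l, i != j -> forall x : V, x \in B i ->
         #|[set y in B j | e x y]| = 1)].

(* An inhabitant is a choice of welds exhibiting G[A] as a transposition-like *)
(* graph of rank n; hence the sort Type rather than Prop.                     *)
Inductive welding_process (V : finType) (e : rel V) : nat -> {set V} -> Type :=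
| Rank1 (A : {set V}) :
    hamiltonian_connected e A \/ hamiltonian_laceable e A ->
    welding_process e 1 A
| Weld (n : nat) (A : {set V}) (l : nat) (B : 'I_l -> {set V}) :
    n.+2 <= l -> weld e A B ->
    (forall i : 'I_l, welding_process e n.+1 (B i)) ->
    welding_process e n.+2 A.

Fixpoint rank1_piece (V : finType) (e : rel V) (n : nat) (A : {set V})
    (w : welding_process e n A) (C : {set V}) {struct w} : Prop :=
  match w with
  | @Rank1 _ _ A0 _ => C = A0
  | @Weld _ _ _ _ l _ _ _ ws => exists i : 'I_l, rank1_piece (ws i) C
  end.

Definition has_pdpc (V : finType) (e : rel V) (k : nat) (s t : 'I_k -> V) : Prop :=
  exists P : 'I_k -> seq V,
    (forall i : 'I_k, path_between e (s i) (t i) (P i)) /\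
    disjoint_union (fun i => [set:: s i :: P i]) [set: V].

(* Main.v *)
Require Import Defs.
From HB Require Import structures.
From mathcomp Require Import all_boot all_order all_algebra.
From mathcomp Require Import zify.

Set Implicit Arguments.
Unset Strict Implicit.
Unset Printing Implicit Defensive.

(** Colour the vertices black ([V1]) and white ([V2]).  A list of pairs, each
    consisting of a black and a white vertex, is _demanded_ of a vertex set when
    the set is to be partitioned into paths joining the pairs.  By induction
    along the welding process, a piece of rank [n >= 2] meets every nonempty
    demand of at most [n.-1] pairs ([process_linked]).  The induction also yields
    that such a piece has at least [2 * n.-1 - 1] vertices of each colour, which
    makes all the choices of edges below possible.

    Let the pieces of a weld meet demands of up to [K] pairs, and let there be at
    least [K.+2] pieces.  A pair joining two pieces is cut at an edge of the
    matching between them, which leaves a demand in each of the two; a piece that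
    no pair touches is filled afterwards by a detour from some edge.  Hence a
    demand is met as soon as every piece is touched by at most [K] of its pairs
    ([route]).  So the only obstacle to [K.+1] pairs is a piece [j1] that all of
    them touch.  The proof then gives up control of something inside [j1] and
    repairs the effect in the other pieces, most of which are nearly empty:

    - If all black ends lie in [j1], one of them is dropped from the demands of
      [j1] and thus turns up inside one of the paths covering [j1].  On a path that
      leaves [j1], this merely permutes the exits, whose positions are arbitrary
      ([free_exits], [exits_route], [overload_two_pieces]).  On a path between two
      ends in [j1], the gap that it causes has two white ends; this wrong parity
      is repaired by cutting a Hamiltonian path of another piece in two
      ([overload_gap]).  When both ends of all pairs lie in [j1], a whole pair is
      dropped ([overload_internal]).
    - If all white ends lie in [j1], exchange the colours.
    - Otherwise some pairs [(s1, t1)] and [(s2, t2)] have only [s1], respectively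
      only [t2], in [j1].  After exchanging partners, [(s1, t2)] is one demand of
      [j1], and its path is cut behind [s1] and rerouted ([overload_mixed]).

    At rank 1 the pieces are single vertices or have a Hamiltonian path between
    any black and any white vertex ([even_rank1_linked]); a bipartite weld of
    single vertices is a single edge ([weld_singletons_linked]). *)

(** * Permutations of lists and choices in finite sets *)

(** Decides [perm_eq] between lists built from the same parts by concatenation:
    counting an arbitrary predicate turns it into linear arithmetic. *)
Ltac perm_solve :=
  apply/permP => ? /=; rewrite ?count_cat /= ?count_cat /=;
  repeat (let n := fresh in set n := nat_of_bool _; clearbody n);
  repeat (let n := fresh in set n := count _ _; clearbody n);
  repeat match goal with H : nat |- _ => revert H end;
  clear; intros; lia.

Lemma perm_map_cons (T U : eqType) (f : T -> U) (s : seq T) y (t : seq U) :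
  perm_eq (map f s) (y :: t) ->
  exists x s', [/\ perm_eq s (x :: s'), f x = y & perm_eq (map f s') t].
Proof.
move=> st; have /mapP[x xs yx] : y \in map f s.
  by rewrite (perm_mem st) mem_head.
exists x, (rem x s); split=> //; first exact: perm_to_rem.
rewrite -(perm_cons y) -(permPr st) yx -map_cons perm_sym.
exact: perm_map (perm_to_rem xs).
Qed.

Lemma perm_zip_unzip1 (T U : eqType) (D : seq (T * U)) (ss : seq T) :
  perm_eq (unzip1 D) ss ->
  exists2 es, size es = size ss & perm_eq D (zip ss es).
Proof.
elim: ss D => [|s ss IH] D.
  move=> /perm_size; rewrite size_map => /size0nil ->.
  by exists [::].
move=> /(@perm_map_cons _ _ fst)[[s' b] [D' [DE /= <- /IH[es sz DE']]]].
exists (b :: es); first by rewrite /= sz.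
by rewrite (permPl DE) /= perm_cons.
Qed.

Lemma perm_cons_of (T : eqType) (x : T) s t u :
  perm_eq (s ++ t) (x :: u) ->
  (exists2 s', perm_eq s (x :: s') & perm_eq u (s' ++ t)) \/
  (exists2 t', perm_eq t (x :: t') & perm_eq u (s ++ t')).
Proof.
move=> st; have : x \in s ++ t by rewrite (perm_mem st) mem_head.
rewrite mem_cat => /orP[] /perm_to_rem xE.
  left; exists (rem x s) => //; rewrite -(perm_cons x) -(permPl st) -cat_cons.
  by rewrite perm_cat2r.
right; exists (rem x t) => //; rewrite -(perm_cons x) -(permPl st).
have : perm_eq (s ++ t) (s ++ x :: rem x t) by rewrite perm_cat2l.
by move=> /permPl ->; perm_solve.
Qed.

Lemma card_preim_le (T U : finType) (A : {set T}) (g : T -> U) (F : seq U) :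
  {in A &, injective g} -> #|[set x in A | g x \in F]| <= size F.
Proof.
move=> gI; rewrite -(card_in_imset (f := g)); last first.
  by move=> x y /[!inE] /andP[xA _] /andP[yA _]; apply: gI.
apply: leq_trans (card_size F); apply/subset_leq_card/subsetP => y.
by case/imsetP=> x /[!inE] /andP[_ gx] ->.
Qed.

(** The bound behind every free choice of an edge: two injective functions can
    avoid two finite lists simultaneously on any set larger than the two
    together. *)
Lemma avoid2 (T : finType) (A : {set T}) (g1 g2 : T -> T) (F1 F2 : seq T) :
  {in A &, injective g1} -> {in A &, injective g2} ->
  size F1 + size F2 < #|A| ->
  exists x, [/\ x \in A, g1 x \notin F1 & g2 x \notin F2].
Proof.
move=> g1I g2I szF.
have := leq_add (card_preim_le F1 g1I) (card_preim_le F2 g2I).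
set A1 := [set _ | _]; set A2 := [set _ | _] => le12.
have /subsetPn[x xA] : ~~ (A \subset A1 :|: A2).
  apply/negP => /subset_leq_card AU.
  by have := leq_trans AU (leq_card_setU A1 A2); lia.
by rewrite !inE xA /= negb_or => /andP[x1 x2]; exists x.
Qed.

Lemma pick_uniq_seq (T : finType) (A : {set T}) (F : seq T) k :
  size F + k <= #|A| ->
  exists xs, [/\ size xs = k, uniq xs, {subset xs <= A}
                & {in xs, forall x, x \notin F}].
Proof.
move=> szk; set E := enum (A :\: [set x in F]).
have kE : k <= size E.
  rewrite -cardE cardsD leq_subRL; last exact: subset_leq_card (subsetIl _ _).
  apply: leq_trans szk; rewrite leq_add2r; apply: leq_trans (card_size F).
  by rewrite -[X in _ <= X]cardsE subset_leq_card // subsetIr.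
exists (take k E); split; first by rewrite size_takel.
- by rewrite take_uniq // enum_uniq.
- by move=> x /mem_take; rewrite mem_enum inE => /andP[].
- by move=> x /mem_take; rewrite mem_enum !inE => /andP[].
Qed.

(** * Path covers with prescribed ends *)

Section PathCovers.
Variables (V : finType) (e : rel V).

(** The vertices of [A] are partitioned into paths whose pairs of end vertices
    are, in order, the entries of [D].  A pair [(x, x)] stands for the path
    consisting of [x] alone. *)
Fixpoint pcover (A : {set V}) (D : seq (V * V)) : Prop :=
  if D is d :: D' then
    exists q, [/\ path_between e d.1 d.2 q, [set:: d.1 :: q] \subset A
                & pcover (A :\: [set:: d.1 :: q]) D']
  else A = set0.
Arguments pcover : simpl never.

Lemma pcover_cons (A : {set V}) d D D' :
  (forall A, pcover A D -> pcover A D') -> pcover A (d :: D) -> pcover A (d :: D').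
Proof. by move=> DD' [q [? ? /DD' ?]]; exists q. Qed.

Lemma pcover_swap (A : {set V}) d1 d2 D :
  pcover A [:: d1, d2 & D] -> pcover A [:: d2, d1 & D].
Proof.
move=> /= [q1 [p1 s1 [q2 [p2 s2 cD]]]]; move: s2; rewrite subsetD => /andP[s2 dj].
exists q2; split=> //; exists q1; split=> //; last by rewrite setDDl setUC -setDDl.
by rewrite subsetD s1 disjoint_sym.
Qed.

Lemma pcover_to_front (A : {set V}) s d D :
  pcover A (s ++ d :: D) <-> pcover A (d :: s ++ D).
Proof.
elim: s A => [|d' s IH] A //; split.
  by move=> cA; apply: pcover_swap; apply: pcover_cons cA => A' /IH.
by move=> /pcover_swap cA; apply: pcover_cons cA => A' /IH.
Qed.

Lemma pcover_perm (A : {set V}) D D' : perm_eq D D' -> pcover A D -> pcover A D'.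
Proof.
elim: D D' A => [|d D IH] D' A pD.
  by move: pD; rewrite perm_sym => /perm_nilP ->.
have : d \in D' by rewrite -(perm_mem pD) mem_head.
move=> /path.splitPr sD; case: sD pD => D1 D2 pD cA.
apply/pcover_to_front; apply: pcover_cons cA => A'; apply: IH.
by rewrite -(perm_cons d) (permPl pD); perm_solve.
Qed.

Lemma pcover_cat (A1 A2 : {set V}) D1 D2 :
  [disjoint A1 & A2] -> pcover A1 D1 -> pcover A2 D2 ->
  pcover (A1 :|: A2) (D1 ++ D2).
Proof.
elim: D1 A1 => [|d D1 IH] A1 dj /=; first by move=> ->; rewrite set0U.
case=> q [pq sq c1] c2; exists q; split=> //.
  exact: subset_trans sq (subsetUl _ _).
have -> : (A1 :|: A2) :\: [set:: d.1 :: q] = (A1 :\: [set:: d.1 :: q]) :|: A2.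
  rewrite setDUl; congr (_ :|: _); apply/setDidPl.
  by rewrite disjoint_sym; apply: disjointWl sq dj.
by apply: IH => //; apply: disjointWl dj; apply: subsetDl.
Qed.

Lemma pcover_join (A : {set V}) x y z w D :
  e y z -> pcover A [:: (x, y), (z, w) & D] -> pcover A ((x, w) :: D).
Proof.
move=> eyz /= [q1 [[/= pq1 lq1 u1] s1 [q2 [[/= pq2 lq2 u2] s2 cD]]]].
move: s2; rewrite subsetD => /andP[s2 dj].
have qE : [set:: x :: q1 ++ z :: q2] = [set:: x :: q1] :|: [set:: z :: q2].
  by apply/setP=> v; rewrite !inE mem_cat !inE !orbA.
exists (q1 ++ z :: q2); split=> /=.
- split=> //; first by rewrite cat_path pq1 lq1 /= eyz.
    by rewrite last_cat.
  rewrite -cat_cons cat_uniq; apply/and3P; split=> //; apply/hasPn => v vq.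
  have vz : v \in [set:: z :: q2] by rewrite in_set.
  by move: (disjointFr dj vz); rewrite in_set => /negbT.
- by rewrite qE subUset s1.
- by rewrite qE -setDDl.
Qed.

Lemma pcover_cut (A : {set V}) a b q1 x q2 D :
  path_between e a b (q1 ++ x :: q2) -> [set:: a :: q1 ++ x :: q2] \subset A ->
  pcover (A :\: [set:: a :: q1 ++ x :: q2]) D ->
  e (last a q1) x /\ pcover A [:: (a, last a q1), (x, b) & D].
Proof.
have qE : [set:: a :: q1 ++ x :: q2] = [set:: a :: q1] :|: [set:: x :: q2].
  by apply/setP=> v; rewrite !inE mem_cat !inE !orbA.
rewrite qE -setDDl => -[]; rewrite cat_path last_cat -cat_cons cat_uniq.
move=> /and3P[p1 ex p2] lq /and3P[u1 /hasPn dj u2].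
rewrite subUset => /andP[s1 s2] cD; split=> //.
exists q1; split=> //; exists q2; split=> //=.
rewrite subsetD s2; rewrite disjoint_subset; apply/subsetP => v.
by rewrite in_set => /dj; rewrite !inE.
Qed.

(** Which path contains [x] is not known in advance: the conclusion names its
    ends.  The second half starts at [x], so that the edge entering [x] is free. *)
Lemma pcover_split (A : {set V}) D x :
  pcover A D -> x \in A ->
  exists a b D', perm_eq D ((a, b) :: D') /\
    (x = a \/ exists2 u, e u x & pcover A [:: (a, u), (x, b) & D']).
Proof.
elim: D A => [|[a b] D IH] A; first by move=> -> /[!inE].
case=> q [/= pq sq cD] xA; case xq: (x \in a :: q).
  exists a, b, D; split=> //; move: xq; rewrite inE => /predU1P[->|xq]; first by left.
  right; case/path.splitPr: xq pq sq cD => q1 q2 pq sq cD.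
  by have [ex cA] := pcover_cut pq sq cD; exists (last a q1).
have xA' : x \in A :\: [set:: a :: q] by rewrite 2!inE xq.
have [a' [b' [D' [DE xE]]]] := IH _ cD xA'.
exists a', b', ((a, b) :: D'); split.
  by rewrite -(perm_cons (a, b)) in DE; rewrite (permPl DE); perm_solve.
case: xE => [->|[u eu cA]]; first by left.
right; exists u => //; apply: (@pcover_perm _ [:: (a, b), (a', u), (x, b') & D']).
  perm_solve.
by exists q.
Qed.

Lemma pcover_ham_split (A : {set V}) a b x :
  pcover A [:: (a, b)] -> x \in A -> x != a ->
  exists2 u, e u x & pcover A [:: (a, u); (x, b)].
Proof.
move=> cA xA xa; have [a' [b' [D [P xE]]]] := pcover_split cA xA.
have D0 : D = [::].
  by have /eqP := perm_size P; rewrite eqSS eq_sym size_eq0 => /eqP.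
have [aE bE] : a' = a /\ b' = b.
  by have := mem_head (a', b') D; rewrite -(perm_mem P) inE => /eqP[-> ->].
case: xE => [xE|[u eu cu]]; first by rewrite xE aE eqxx in xa.
by exists u => //; rewrite -aE -bE -D0.
Qed.

Lemma pcover_first_edge (A : {set V}) a b D :
  a != b -> pcover A ((a, b) :: D) ->
  exists2 v, e a v & pcover A [:: (a, a), (v, b) & D].
Proof.
move=> ab /= [[|v q] [pq sq cD]]; first by case: pq ab => _ /= ->; rewrite eqxx.
by have [] := @pcover_cut A a b [::] v q D pq sq cD; exists v.
Qed.

(** The second half of a cut Hamiltonian path starts at the successor of the last
    vertex of the first half.  That this successor is an injective function of it
    allows a choice of the cut subject to conditions on both halves. *)
Lemma pcover_ham_cuts (A : {set V}) a b :
  pcover A [:: (a, b)] ->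
  exists nxt : V -> V, injective nxt /\
    forall f, f \in A -> f != b ->
      e f (nxt f) /\ pcover A [:: (a, f); (nxt f, b)].
Proof.
case=> q [/= pq sq cD]; have [_ lq uq] := pq.
exists (path.next (a :: q)); split; first exact: can_inj (path.prev_next uq).
move=> f fA fb; have : f \in a :: q.
  by move/setP/(_ f): cD; rewrite in_set0 in_setD fA andbT in_set => /negbFE.
have fE q1 x q2 : q = q1 ++ x :: q2 -> last a q1 = f ->
    e f (path.next (a :: q) f) /\ pcover A [:: (a, f); (path.next (a :: q) f, b)].
  move=> qE lq1; have -> : path.next (a :: q) f = x.
    have nf : nth a (a :: q) (size q1) = f.
      by rewrite qE -cat_cons nth_cat ltnS leqnn -last_nth.
    have szq : size q1 < size (a :: q) by rewrite qE /= size_cat /=; lia.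
    have fi : index f (a :: q) = size q1 by rewrite -nf index_uniq.
    rewrite path.next_nth fi qE -qE -{1}nf mem_nth // qE.
    by rewrite nth_cat ltnn subnn.
  rewrite qE in pq sq cD; have := @pcover_cut A a b q1 x q2 [::] pq sq cD.
  by rewrite lq1.
rewrite inE => /predU1P[fa|fq].
  case: q {pq sq cD uq} lq fE => [/= ab|x q _ fE]; first by rewrite fa ab eqxx in fb.
  exact: (fE [::] x q).
case/path.splitPr: fq lq fE {pq sq cD uq} => q1 [|x q2] lq fE.
  by rewrite -lq last_cat eqxx in fb.
apply: (fE (rcons q1 f) x q2); first by rewrite cat_rcons.
by rewrite last_rcons.
Qed.

Lemma pcover_unzip1 (A : {set V}) D :
  pcover A D -> uniq (unzip1 D) /\ {subset unzip1 D <= A}.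
Proof.
elim: D A => [|d D IH] A //= [q [_ sq /IH[uD sD]]]; split.
  apply/andP; split=> //; apply/negP => /sD.
  by rewrite !inE eqxx.
move=> x; rewrite inE => /predU1P[->|/sD]; last by rewrite inE => /andP[].
by apply: (subsetP sq); rewrite !inE eqxx.
Qed.

Hypothesis esym : symmetric e.

Lemma pcover_rev (A : {set V}) a b D :
  pcover A ((a, b) :: D) -> pcover A ((b, a) :: D).
Proof.
case=> q [[/= pq lq uq] sq cD].
have E : b :: rev (belast a q) = rev (a :: q) by rewrite [in RHS]lastI rev_rcons lq.
have EA : [set:: b :: rev (belast a q)] = [set:: a :: q].
  by rewrite E; apply/setP=> v; rewrite !in_set mem_rev.
exists (rev (belast a q)); rewrite EA; split=> //; split.
- by rewrite -lq rev_path (eq_path (e' := e)) // => x y; apply: esym.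
- by rewrite -[last _ _]/(last b (b :: rev (belast a q))) E rev_cons last_rcons.
- by rewrite E rev_uniq.
Qed.

Definition flip (d : V * V) := (d.2, d.1).

Lemma pcover_flip (A : {set V}) D : pcover A D -> pcover A (map flip D).
Proof.
elim: D A => [|[a b] D IH] A //= cA.
by apply: (@pcover_rev A a b); apply: pcover_cons cA.
Qed.

Lemma pcover_unzip2 (A : {set V}) D :
  pcover A D -> uniq (unzip2 D) /\ {subset unzip2 D <= A}.
Proof.
move=> /pcover_flip/pcover_unzip1; rewrite /unzip1 -map_comp.
by have -> : [seq (fst \o flip) d | d <- D] = unzip2 D by [].
Qed.

(** Many joins at once, the [i]-th entry of [ys] being adjacent to the [i]-th
    entry of [zs]. *)
Lemma pcover_join_zip (A : {set V}) xs ys zs ws D :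
  size xs = size ys -> size ys = size zs -> size zs = size ws -> all2 e ys zs ->
  pcover A (zip xs ys ++ zip zs ws ++ D) -> pcover A (zip xs ws ++ D).
Proof.
elim: xs ys zs ws A => [|x xs IH] [|y ys] [|z zs] [|w ws] A //=.
move=> [xy] [yz] [zw] /andP[eyz eys] cA.
have : pcover A [:: (x, y), (z, w) & zip xs ys ++ zip zs ws ++ D].
  by apply: pcover_perm cA; perm_solve.
by move=> /(pcover_join eyz); apply: pcover_cons => A'; apply: IH.
Qed.

End PathCovers.
Arguments pcover {V} e A D : simpl never.

(** The tactics below compute with the end pairs of a path cover: they look up the
    paths concerned in the list, move them to its front and apply a lemma. *)
Ltac del_pair d L :=
  lazymatch L with
  | cons ?h ?t =>
    match goal with
    | _ =>
      let _ := lazymatch constr:((d, h)) with ((?x, ?y), (?x', ?y')) =>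
        match goal with _ => constr_eq x x'; constr_eq y y' end end in
      constr:(t)
    | _ => let r := del_pair d t in constr:(cons h r)
    end
  | cat ?s ?t =>
    match goal with
    | _ => let r := del_pair d s in constr:(cat r t)
    | _ => let r := del_pair d t in constr:(cat s r)
    end
  end.

Ltac pair_ending_at y L :=
  match L with
  | cons (?x, ?y') _ =>
    let _ := match goal with _ => constr_eq y y' end in constr:((x, y'))
  | cons _ ?t => pair_ending_at y t
  | cat ?s _ => pair_ending_at y s
  | cat _ ?t => pair_ending_at y t
  end.

Ltac pair_starting_at x L :=
  match L with
  | cons (?x', ?y) _ =>
    let _ := match goal with _ => constr_eq x x' end in constr:((x', y))
  | cons _ ?t => pair_starting_at x t
  | cat ?s _ => pair_starting_at x s
  | cat _ ?t => pair_starting_at x t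
  end.

(** For [E : e y z], the path ending at [y] and the path starting at [z] of the
    cover [H] become one. *)
Ltac join H E :=
  lazymatch type of H with pcover ?e ?A ?D =>
    lazymatch type of E with is_true (_ ?y ?z) =>
      let p := pair_ending_at y D in
      let D1 := del_pair p D in
      let q := pair_starting_at z D1 in
      let D2 := del_pair q D1 in
      let H' := fresh in
      assert (H' : pcover e A (p :: q :: D2)) by (apply: pcover_perm H; perm_solve);
      clear H; assert (H := pcover_join E H'); clear H'
    end
  end.

Ltac turn H S x :=
  lazymatch type of H with pcover ?e ?A ?D =>
    let p := pair_starting_at x D in
    let D1 := del_pair p D in
    let H' := fresh in
    assert (H' : pcover e A (p :: D1)) by (apply: pcover_perm H; perm_solve);
    clear H; assert (H := pcover_rev S H'); clear H'
  end.

(** * Demands and welds *)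

Lemma perm_filter_or (T : eqType) (a b : pred T) (s : seq T) :
  (forall x, a x -> ~~ b x) ->
  perm_eq [seq x <- s | a x || b x] ([seq x <- s | a x] ++ [seq x <- s | b x]).
Proof.
move=> ab; elim: s => //= x s IH; have := ab x.
case: (a x) => [/(_ isT)/negbTE -> /=|_ /=]; first by rewrite perm_cons.
by case: (b x) => //; rewrite -(perm_cons x) in IH; rewrite (permPl IH); perm_solve.
Qed.

Section Demands.
Variables (V : finType) (e : rel V) (col : pred V).

(** Vertices satisfying [col] are called black, the others white.  Since the ends
    of a pair have different colours, no vertex can occur twice among the ends. *)
Definition demand (D : seq (V * V)) :=
  [&& all (fun d => col d.1 && ~~ col d.2) D, uniq (unzip1 D) & uniq (unzip2 D)].

Definition ends_in (A : {set V}) (D : seq (V * V)) :=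
  all (fun d => (d.1 \in A) && (d.2 \in A)) D.

(** The empty demand is excluded because only the empty set could meet it. *)
Definition linked K (A : {set V}) :=
  forall D, D != [::] -> size D <= K -> demand D -> ends_in A D -> pcover e A D.

Lemma col_neq x y : col x -> ~~ col y -> x != y.
Proof. by move=> cx; apply: contraNneq => <-. Qed.

Lemma demand_cons d D :
  demand (d :: D) = [&& col d.1, ~~ col d.2, d.1 \notin unzip1 D,
                        d.2 \notin unzip2 D & demand D].
Proof.
rewrite /demand /=; apply/idP/idP.
  by case/and3P=> /andP[/andP[-> ->] ->] /andP[-> ->] /andP[-> ->].
by case/and5P=> -> -> -> -> /and3P[-> -> ->].
Qed.

Lemma demand_perm D D' : perm_eq D D' -> demand D = demand D'.
Proof.
move=> DD'; rewrite /demand (perm_all _ DD').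
by rewrite (perm_uniq (perm_map fst DD')) (perm_uniq (perm_map snd DD')).
Qed.

Lemma demand_catr D D' : demand (D ++ D') -> demand D'.
Proof. by elim: D => //= d D IH; rewrite demand_cons => /and5P[_ _ _ _ /IH]. Qed.

Lemma demand_filter a D : demand D -> demand (filter a D).
Proof.
move=> dD; apply: (@demand_catr (filter (predC a) D)).
by rewrite -(@demand_perm D) // perm_sym perm_catC perm_filterC.
Qed.

Lemma demand_zip ss ts :
  size ss = size ts ->
  demand (zip ss ts) = [&& all col ss, all (predC col) ts, uniq ss & uniq ts].
Proof.
move=> sz; rewrite /demand unzip1_zip ?unzip2_zip ?sz // !andbA; congr (_ && _ && _).
by elim: ss ts sz => [|s ss IH] [|t ts] //= [/IH ->]; rewrite andbACA.
Qed.

Lemma linked_flip K A :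
  symmetric e -> linked K A ->
  forall D, D != [::] -> size D <= K ->
    [&& all (fun d => ~~ col d.1 && ~~ ~~ col d.2) D, uniq (unzip1 D)
      & uniq (unzip2 D)] -> ends_in A D -> pcover e A D.
Proof.
move=> esym lA D D0 szD /and3P[aD u1 u2] eD.
have -> : D = map (@flip V) (map (@flip V) D).
  by rewrite -map_comp map_id_in // => -[].
apply: (pcover_flip esym); apply: lA; rewrite ?size_map //.
- by rewrite -size_eq0 size_map size_eq0.
- rewrite /demand /unzip1 /unzip2 -!map_comp u1 u2 !andbT all_map.
  by apply: sub_all aD => d /=; rewrite negbK andbC.
- rewrite /ends_in all_map; apply: sub_all eD => d /=.
  by rewrite andbC.
Qed.

End Demands.

Section Weld.
Variables (V : finType) (e : rel V) (I : finType) (c : V -> I).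

Notation piece j := [set x | c x == j].
Notation union J := [set x | c x \in J].

(** A weld seen from inside the ambient graph: [c x] is the index of the piece
    containing [x], [J0] is the set of indices of the pieces, and [nb j x] is the
    neighbour of [x] in the piece [j].  The bound [weld_card] leaves a free
    matching edge between two pieces when each of them has to meet [K.-1] other
    pairs. *)
Record welded (col : pred V) (nb : I -> V -> V) (J0 : {set I}) (K : nat) : Prop := {
  weld_sym : symmetric e;
  weld_col : forall x y, e x y -> col y = ~~ col x;
  weld_nbc : forall j x, j \in J0 -> c x \in J0 -> c x != j -> c (nb j x) = j;
  weld_nbe : forall j x, j \in J0 -> c x \in J0 -> c x != j -> e x (nb j x);
  weld_nbI : forall j x y, j \in J0 -> c x \in J0 -> c x = c y -> c x != j ->
    nb j x = nb j y -> x = y;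
  weld_pos : 0 < K;
  weld_linked : forall j, j \in J0 -> linked e col K (piece j);
  weld_card : forall j b, j \in J0 -> 2 * K <= #|[set x in piece j | col x == b]|.+1
}.

Lemma welded_flip col nb J0 K :
  welded col nb J0 K -> welded (predC col) nb J0 K.
Proof.
case=> Wsym Wcol Wnbc Wnbe WnbI Wpos Wlink Wcard; split=> //.
- by move=> x y /= /Wcol ->.
- by move=> j jJ D D0 szD dD; apply: (linked_flip Wsym (Wlink j jJ)).
- move=> j b jJ; have := Wcard j (~~ b) jJ.
  suff -> : [set x in piece j | col x == ~~ b] = [set x in piece j | predC col x == b].
    by [].
  by apply/setP=> x; rewrite !inE /=; case: (col x) b => -[].
Qed.

Variables (col : pred V) (nb : I -> V -> V) (J0 : {set I}) (K : nat).
Hypothesis W : welded col nb J0 K.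

Let esym : symmetric e := weld_sym W.
Let ecol := weld_col W.
Let nbc := weld_nbc W.
Let nbe := weld_nbe W.
Let nbI := weld_nbI W.
Let Kpos := weld_pos W.
Let plink := weld_linked W.
Let pcard := weld_card W.

Lemma nb_col j x : j \in J0 -> c x \in J0 -> c x != j -> col (nb j x) = ~~ col x.
Proof. by move=> jJ xJ xj; apply/ecol/nbe. Qed.

Lemma edge_col x y : e x y -> col x = ~~ col y.
Proof. by move/ecol ->; rewrite negbK. Qed.

Definition touch j (d : V * V) := (c d.1 == j) || (c d.2 == j).
Definition load j (D : seq (V * V)) := count (touch j) D.

Lemma pcover_addU (J : {set I}) j D1 D2 :
  j \notin J -> pcover e (piece j) D1 -> pcover e (union J) D2 ->
  pcover e (union (j |: J)) (D1 ++ D2).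
Proof.
move=> jJ c1 c2; have -> : union (j |: J) = piece j :|: union J.
  by apply/setP=> x; rewrite !inE.
apply: pcover_cat => //; rewrite disjoint_subset; apply/subsetP=> x.
by rewrite !inE => /eqP ->.
Qed.

Lemma pcover_addD (J : {set I}) j D1 D2 :
  j \in J -> pcover e (piece j) D1 -> pcover e (union (J :\ j)) D2 ->
  pcover e (union J) (D1 ++ D2).
Proof. by move=> jJ; rewrite -{2}(setD1K jJ); apply: pcover_addU; rewrite !inE eqxx. Qed.

Lemma piece_ham j x y :
  j \in J0 -> c x = j -> c y = j -> col x -> ~~ col y -> pcover e (piece j) [:: (x, y)].
Proof.
move=> jJ xj yj cx cy; apply: (plink jJ) => //; first by rewrite demand_cons cx cy.
by rewrite /ends_in /= !inE xj yj eqxx.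
Qed.

(** An untouched piece is absorbed by detouring an arbitrary edge of a path
    through it: the neighbours of the ends of that edge have opposite colours. *)
Lemma pcover_insert (J : {set I}) j D :
  J \subset J0 -> j \in J0 -> j \notin J -> D != [::] -> demand col D ->
  pcover e (union J) D -> pcover e (union (j |: J)) D.
Proof.
move=> JJ jJ0 jJ; case: D => [//|[a b] D] _.
rewrite demand_cons /= => /and5P[ca cb _ _ _].
move=> /(pcover_first_edge (col_neq ca cb))[v eav cD].
have aJ : c a \in J by have [_ /(_ a)] := pcover_unzip1 cD; rewrite !inE eqxx => ->.
have vJ : c v \in J.
  by have [_ /(_ v)] := pcover_unzip1 cD; rewrite !inE eqxx orbT => ->.
have aj : c a != j by apply: contraNneq jJ => <-.
have vj : c v != j by apply: contraNneq jJ => <-.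
have aJ0 := subsetP JJ _ aJ; have vJ0 := subsetP JJ _ vJ.
have cv := ecol eav; rewrite ca in cv.
have ham : pcover e (piece j) [:: (nb j v, nb j a)].
  by apply: piece_ham; rewrite ?nbc ?nb_col ?ca ?cv.
have := pcover_addU jJ (pcover_rev esym ham) cD.
move=> cA; have {cA} : pcover e (union (j |: J))
    [:: (a, a), (nb j a, nb j v), (v, b) & D].
  by apply: pcover_perm cA; perm_solve.
move=> /(pcover_join (nbe jJ0 aJ0 aj)); apply: pcover_join.
by rewrite esym nbe.
Qed.

(** ** Routing demands that overload no piece *)

(** One starts from a piece with a demand, so that every piece without one finds
    a path to be detoured. *)
Lemma route_internal (J : {set I}) D :
  J \subset J0 -> D != [::] -> demand col D ->
  all (fun d => (c d.1 == c d.2) && (c d.1 \in J)) D ->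
  (forall j, j \in J -> load j D <= K) ->
  pcover e (union J) D.
Proof.
move=> JJ D0 dD intD ldD.
have [j0 j0J hasj0] : exists2 j, j \in J & has (fun d => c d.1 == j) D.
  case: D D0 intD {dD ldD} => [//|d D] _ /= /andP[/andP[_ dJ] _].
  by exists (c d.1); rewrite //= eqxx.
have one j : j \in J -> has (fun d => c d.1 == j) D ->
    pcover e (piece j) [seq d <- D | c d.1 == j].
  move=> jJ hj; apply: (plink (subsetP JJ _ jJ)).
  - by rewrite -has_filter.
  - rewrite size_filter; apply: leq_trans (ldD _ jJ); apply: sub_count => d /=.
    by rewrite /touch => ->.
  - exact: demand_filter.
  - apply/allP=> d; rewrite mem_filter => /andP[/eqP d1 /(allP intD)/andP[/eqP d2 _]].
    by rewrite !inE -d2 d1 eqxx.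
have part (js : seq I) : all (fun j => j \in J) js ->
    pcover e (union [set i in j0 :: js]) [seq d <- D | c d.1 \in j0 :: js].
  elim: js => [_|j js IH /= /andP[jJ jsJ]].
    have := one _ j0J hasj0; rewrite (eq_filter (a2 := fun d => c d.1 \in [:: j0])).
      by congr (pcover e _ _); apply/setP=> x; rewrite !inE.
    by move=> d; rewrite inE.
  have {}IH := IH jsJ; case jin : (j \in j0 :: js).
    have E x : (x \in [:: j0, j & js]) = (x \in j0 :: js).
      move: jin; rewrite !inE; have [->|//] := eqVneq x j.
      by move=> -> ; rewrite orbT.
    rewrite (eq_filter (a2 := fun d => c d.1 \in j0 :: js)) => [|d]; last exact: E.
    by move: IH; congr (pcover e _ _); apply/setP=> x; rewrite 4!in_set; rewrite E.
  have sub : [set i in j0 :: js] \subset J0.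
    apply/subsetP=> x; rewrite in_set inE => /predU1P[->|/(allP jsJ) xJ];
      exact: (subsetP JJ).
  have jn : j \notin [set i in j0 :: js] by rewrite in_set jin.
  have U : union [set i in [:: j0, j & js]] = union (j |: [set i in j0 :: js]).
    by apply/setP=> x; rewrite !inE orbCA.
  rewrite U.
  have P : perm_eq [seq d <- D | c d.1 \in [:: j0, j & js]]
      ([seq d <- D | c d.1 == j] ++ [seq d <- D | c d.1 \in j0 :: js]).
    rewrite (@eq_filter _ _ (fun d => (c d.1 == j) || (c d.1 \in j0 :: js))).
      by apply: perm_filter_or => d /eqP ->; rewrite jin.
    by move=> d; rewrite !inE orbCA.
  apply: (pcover_perm (D := [seq d <- D | c d.1 == j] ++
                            [seq d <- D | c d.1 \in j0 :: js])).
    by rewrite perm_sym.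
  case hj : (has (fun d => c d.1 == j) D).
    by apply: pcover_addU => //; apply: one.
  have -> : [seq d <- D | c d.1 == j] = [::].
    by apply/eqP; rewrite -[_ == _]negbK -has_filter hj.
  apply: pcover_insert => //; last exact: demand_filter.
    exact: (subsetP JJ).
  rewrite -has_filter; apply: sub_has hasj0 => d /= /eqP ->.
  exact: mem_head.
have := part (enum J); rewrite (eq_in_filter (a2 := predT)) ?filter_predT; last first.
  by move=> d /(allP intD)/andP[_ dJ]; rewrite inE mem_enum dJ orbT.
have -> : union [set i in j0 :: enum J] = union J; last first.
  by apply; apply/allP=> j; rewrite mem_enum.
apply/setP=> x; rewrite !in_set inE mem_enum.
by case: eqP => [->|].
Qed.

Lemma size_firsts_le j D : size [seq x <- unzip1 D | c x == j] <= load j D.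
Proof.
rewrite size_filter count_map; apply: sub_count => d /= dj.
by rewrite /touch dj.
Qed.

Lemma size_seconds_le j D : size [seq x <- unzip2 D | c x == j] <= load j D.
Proof.
rewrite size_filter count_map; apply: sub_count => d /= dj.
by rewrite /touch dj orbT.
Qed.

Lemma load_perm j D D' : perm_eq D D' -> load j D = load j D'.
Proof. by move/permP; apply. Qed.

(** A pair joining two pieces crosses by a matching edge whose ends are still
    free.  In the first piece at most [K.-1] other demands have a white end,
    in the second at most [K.-1] have a black end, and these exclude fewer edges
    than the matching has. *)
Lemma free_edge N s t :
  demand col ((s, t) :: N) -> c s \in J0 -> c t \in J0 -> c s != c t ->
  load (c s) ((s, t) :: N) <= K -> load (c t) ((s, t) :: N) <= K ->
  exists x, [/\ c x = c s, ~~ col x, x \notin unzip2 ((s, t) :: N)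
              & nb (c t) x \notin unzip1 ((s, t) :: N)].
Proof.
rewrite demand_cons => /= /and5P[/= cs ct _ _ _] sJ tJ st.
rewrite /load /= /touch /= !eqxx orbT !add1n => ls lt.
pose A := [set x in piece (c s) | col x == false].
pose F1 := [seq x <- unzip2 N | c x == c s].
pose F2 := [seq x <- unzip1 N | c x == c t].
have [|||x [xA x1 x2]] := @avoid2 V A id (nb (c t)) F1 F2.
- by move=> x y.
- move=> x y; rewrite !inE => /andP[/eqP xs _] /andP[/eqP ys _].
  by apply: nbI; rewrite ?xs ?ys.
- have := pcard false sJ; rewrite -/A.
  have := size_seconds_le (c s) N; rewrite -/F1.
  have := size_firsts_le (c t) N; rewrite -/F2.
  rewrite /load /touch; move: #|A| (size F1) (size F2) ls lt Kpos; lia.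
have [xs xw] : c x = c s /\ ~~ col x.
  by move: xA; rewrite !inE => /andP[/eqP -> /eqP ->].
exists x; split=> //=; rewrite inE negb_or.
  rewrite (contraNneq _ st) => [|<-]; last by rewrite xs.
  by move: x1; rewrite mem_filter xs eqxx.
have xJ : c x \in J0 by rewrite xs.
have cx : c (nb (c t) x) = c t by apply: nbc; rewrite // xs.
rewrite (contraNneq _ st) => [|<-]; last by rewrite cx.
by move: x2; rewrite mem_filter cx eqxx.
Qed.

(** The pairs of [Q] joining different pieces are cut at matching edges.  The
    pairs of [N] are left alone, but their ends are avoided by the new pairs: they
    stand for demands that are going to be met in another way. *)
Lemma expand (J : {set I}) N Q :
  J \subset J0 -> demand col (N ++ Q) -> ends_in (union J) (N ++ Q) ->
  (forall j, j \in J -> load j (N ++ Q) <= K) ->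
  exists R, [/\ demand col (N ++ R),
    all (fun d => (c d.1 == c d.2) && (c d.1 \in J)) R,
    forall j, load j R = load j Q
    & forall A M, pcover e A (M ++ R) -> pcover e A (M ++ Q)].
Proof.
move=> JJ; elim: Q N => [|[s t] Q IH] N dN eN lN; first by exists [::]; split.
have P : perm_eq (N ++ (s, t) :: Q) ((s, t) :: N ++ Q) by perm_solve.
have dP := dN; rewrite (demand_perm _ P) in dP.
have := eN; rewrite /ends_in (perm_all _ P) /= !inE => /andP[/andP[sJ tJ] eNQ].
have [st|st] := eqVneq (c s) (c t).
  have [||j jJ|R [dR iR lR cR]] := IH ((s, t) :: N) => //.
  - by rewrite /ends_in /= !inE sJ tJ.
  - by rewrite -(load_perm _ P) lN.
  exists ((s, t) :: R); split.
  - by rewrite -(demand_perm _ (D := ((s, t) :: N) ++ R)) //; perm_solve.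
  - by rewrite /= st eqxx -st sJ.
  - by move=> j; have := lR j; rewrite /load /= => ->.
  - move=> A M; rewrite -!cat_rcons; exact: cR.
have sJ0 := subsetP JJ _ sJ; have tJ0 := subsetP JJ _ tJ.
have [||x [xs xw x2 x1]] := free_edge dP sJ0 tJ0 st.
- by rewrite -(load_perm _ P) lN.
- by rewrite -(load_perm _ P) lN.
have xJ0 : c x \in J0 by rewrite xs.
have xt : c x != c t by rewrite xs.
set y := nb (c t) x in x1.
have cy : c y = c t by apply: nbc.
have yb : col y by rewrite nb_col.
have exy : e x y by apply: nbe.
have [||j jJ|R [dR iR lR cR]] := IH [:: (s, x), (y, t) & N].
- move: dP x1 x2; rewrite !cat_cons !demand_cons /= !inE !negb_or.
  move=> /and5P[-> -> -> -> ->] /andP[ys ->] /andP[-> ->].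
  by rewrite xw yb eq_sym ys.
- by rewrite /ends_in /= !inE sJ tJ xs cy sJ tJ.
- apply: leq_trans (lN j jJ); rewrite (load_perm _ P) /load /= /touch /= xs cy.
  by rewrite !orbb addnA leq_add2r; case: (c s =P j) (c t =P j) st => [->|_] [->|_] //;
     rewrite eqxx.
exists [:: (s, x), (y, t) & R]; split.
- by rewrite -(demand_perm _ (D := [:: (s, x), (y, t) & N] ++ R)) //; perm_solve.
- by rewrite /= xs cy !eqxx sJ tJ.
- move=> j; have := lR j; rewrite /load /= /touch /= xs cy !orbb => ->.
  rewrite addnA; congr (_ + _).
  by case: (c s =P j) (c t =P j) st => [->|_] [->|_] //; rewrite eqxx.
move=> A M cA; rewrite -cat_rcons; apply: cR.
have {}cA : pcover e A [:: (s, x), (y, t) & M ++ R].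
  by apply: pcover_perm cA; perm_solve.
have := pcover_join exy cA; apply: pcover_perm; rewrite cat_rcons.
perm_solve.
Qed.

Lemma route (J : {set I}) Q :
  J \subset J0 -> Q != [::] -> demand col Q -> ends_in (union J) Q ->
  (forall j, j \in J -> load j Q <= K) -> pcover e (union J) Q.
Proof.
move=> JJ Q0 dQ eQ lQ.
have [R [dR iR lR cR]] := @expand J [::] Q JJ dQ eQ lQ.
apply: (cR _ [::]); apply: route_internal => // [|j jJ]; last by rewrite lR lQ.
case: Q Q0 eQ lR {dQ lQ cR} => [//|d Q] _ /= _ /(_ (c d.1)).
by case: R {dR iR} => //; rewrite /load /= /touch eqxx.
Qed.

(** The two halves [(a, f)] and [(g, b)] of a Hamiltonian path have ends of equal
    colours.  They serve to correct the parity of two paths passing through the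
    piece; the lists [F1] and [F2] hold the ends already in use in the pieces
    [j1] and [j2] where these paths continue. *)
Lemma ham_cut j a b j1 j2 F1 F2 :
  j \in J0 -> j1 \in J0 -> j2 \in J0 -> j1 != j -> j2 != j ->
  c a = j -> c b = j -> col b = ~~ col a -> size F1 + size F2 <= 2 * K.-1 ->
  exists f g, [/\ c f = j /\ c g = j, col f = col a /\ col g = col b,
    nb j1 f \notin F1, nb j2 g \notin F2
    & pcover e (piece j) [:: (a, f); (g, b)]].
Proof.
move=> jJ j1J j2J j1j j2j aj bj cab szF.
have : pcover e (piece j) [:: (a, b)].
  case ca : (col a) cab => /= cb; first by apply: piece_ham; rewrite ?cb.
  by apply: (pcover_rev esym); apply: piece_ham; rewrite ?ca ?cb.
case/pcover_ham_cuts => nxt [nxtI cut].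
pose A := [set x in piece j | col x == col a].
have inA f : f \in A -> [/\ c f = j, col f = col a, c (nxt f) = j,
    e f (nxt f) & pcover e (piece j) [:: (a, f); (nxt f, b)]].
  rewrite !inE => /andP[/eqP fj /eqP fa].
  have [] := cut f; first by rewrite inE fj.
    by apply/eqP=> fb; move: cab; rewrite -fb fa; case: (col a).
  move=> ef cf; split=> //; have [_ /(_ (nxt f))] := pcover_unzip1 cf.
  by rewrite !inE eqxx orbT => /(_ isT)/eqP.
have [|||f [fA f1 f2]] := @avoid2 V A (nb j1) (nb j2 \o nxt) F1 F2.
- move=> x y /inA[xj _ _ _ _] /inA[yj _ _ _ _].
  by apply: nbI; rewrite ?xj ?yj // eq_sym.
- move=> x y /inA[_ _ xj _ _] /inA[_ _ yj _ _] /= xy; apply: nxtI.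
  by apply: (@nbI j2); rewrite ?xj ?yj // eq_sym.
- apply: leq_ltn_trans szF _; have : 2 * K <= #|A|.+1 := pcard (col a) jJ.
  by move: #|A| Kpos; clear; lia.
have [fj ca gj efg cf] := inA f fA.
by exists f, (nxt f); split=> //; split=> //; rewrite (ecol efg) ca cab.
Qed.

(** ** Covering the overloaded piece *)

Lemma pick_piece (F : seq I) : size F < #|J0| -> exists2 j, j \in J0 & j \notin F.
Proof.
rewrite -addn1 => /pick_uniq_seq[[|j [|? ?]] [//= _ _ jJ jF]].
by exists j; rewrite ?jJ ?jF ?mem_head.
Qed.

Lemma piece_ends j D :
  pcover e (piece j) D -> all (fun d => (c d.1 == j) && (c d.2 == j)) D.
Proof.
move=> cD; apply/allP=> d dD.
have [_ /(_ d.1)] := pcover_unzip1 cD; have [_ /(_ d.2)] := pcover_unzip2 esym cD.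
by rewrite !inE !map_f // => -> // ->.
Qed.

Lemma load0_notin j x D :
  load j D = 0 -> c x = j -> (x \notin unzip1 D) /\ (x \notin unzip2 D).
Proof.
move=> l0 xj; have n0 d : d \in D -> ~~ touch j d.
  move=> dD; apply/negP=> td; have : 0 < load j D.
    by rewrite -has_count; apply/hasP; exists d.
  by rewrite l0.
split; apply/mapP=> -[d dD xd]; move: (n0 d dD); rewrite /touch -xd xj eqxx //.
by rewrite orbT.
Qed.

(** With one black vertex [s] too many, [s] is left out of the demands and turns up
    inside one of the paths, which is cut in front of [s].  If that path leads from
    a black vertex [a] of [s :: ss] to an exit [b], then its two halves lead from
    [a] and from [s] to white exits.  Otherwise it is a path of [In]. *)
Lemma free_exits j In s ss :
  j \in J0 -> demand col In -> ends_in (piece j) In ->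
  all col (s :: ss) -> all (fun x => c x == j) (s :: ss) ->
  uniq (unzip1 In ++ s :: ss) -> size In + size ss = K ->
  (exists es, [/\ size es = (size ss).+1, all (predC col) es
     & pcover e (piece j) (In ++ zip (s :: ss) es)]) \/
  (exists a b In' u v es, [/\ perm_eq In ((a, b) :: In'), e u s /\ e s v,
     size es = size ss, all (predC col) es
     & pcover e (piece j) ([:: (a, u); (s, s); (v, b)] ++ In' ++ zip ss es)]).
Proof.
move=> jJ dIn eIn cs js us szK.
pose A := [set x in piece j | col x == false].
have [|xs [szx ux xA xF]] := @pick_uniq_seq V A (unzip2 In) (size ss).
  have : 2 * K <= #|A|.+1 := pcard false jJ.
  by rewrite size_map szK; move: #|A| Kpos; clear; lia.
have z1 : map fst (zip ss xs) = ss by apply: unzip1_zip; rewrite szx.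
have z2 : map snd (zip ss xs) = xs by apply: unzip2_zip; rewrite szx.
have /= /andP[sc ssc] := cs; have /= /andP[/eqP sj ssj] := js.
have us' : uniq (s :: unzip1 In ++ ss).
  by rewrite -(@perm_uniq _ (unzip1 In ++ s :: ss)) //; perm_solve.
have xw : all (predC col) xs.
  by apply/allP=> x /xA; rewrite !inE => /andP[_ /eqP /= ->].
have cA : pcover e (piece j) (In ++ zip ss xs).
  apply: plink => //.
  - by rewrite -size_eq0 size_cat size_zip szx minnn szK -lt0n.
  - by rewrite size_cat size_zip szx minnn szK.
  - have /and3P[aI u1 u2] := dIn.
    have := @demand_zip V col ss xs (Logic.eq_sym szx); rewrite ssc xw ux andbT.
    have /= /andP[_] := us'; rewrite cat_uniq => /and3P[_ h1 us2].
    rewrite us2 => /and3P[aZ _ _].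
    rewrite /demand all_cat aI aZ /unzip1 /unzip2 !map_cat z1 z2 !cat_uniq.
    rewrite u1 us2 u2 ux h1 !andbT /=; apply/hasPn=> x /xF.
    by [].
  - rewrite /ends_in all_cat; apply/andP; split; first exact: eIn.
    apply/allP=> d dz; rewrite !inE.
    have d1 : d.1 \in ss by rewrite -z1 map_f.
    have d2 : d.2 \in xs by rewrite -z2 map_f.
    by move: (allP ssj _ d1) (xA _ d2) => ->; rewrite !inE => /andP[].
have sA : s \in piece j by rewrite inE sj.
have [a [b [D' [P [sa|[u eus cA']]]]]] := pcover_split cA sA.
  have : s \in unzip1 (In ++ zip ss xs).
    by rewrite (perm_mem (perm_map fst P)) /= sa mem_head.
  by rewrite /unzip1 map_cat z1; move: us' => /= /andP[/negP].
case/perm_cons_of: (P) => [[In' PI PD]|[Z PZ PD]].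
  right; have /andP[/= _ wb] : col a && ~~ col b.
    have /and3P[/allP aI _ _] := dIn; apply: (aI (a, b)).
    by rewrite (perm_mem PI) mem_head.
  have {}cA' : pcover e (piece j) [:: (s, b), (a, u) & D'].
    by apply: pcover_perm cA'; perm_solve.
  have [v esv cv] := pcover_first_edge (col_neq sc wb) cA'.
  exists a, b, In', u, v, xs; split=> //; apply: pcover_perm cv.
  apply: (@perm_trans _ ([:: (s, s); (v, b); (a, u)] ++ In' ++ zip ss xs)).
    by rewrite /= !perm_cons.
  perm_solve.
left.
have PS : perm_eq (unzip1 [:: (s, b), (a, u) & Z]) (s :: ss).
  by rewrite /= perm_cons -z1 perm_sym (perm_map fst PZ).
have [es sze PE] := perm_zip_unzip1 PS; exists es; split=> //.
  have z2e : unzip2 (zip (s :: ss) es) = es by apply: unzip2_zip; rewrite sze.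
  rewrite -z2e -(perm_all _ (perm_map snd PE)) /= (edge_col eus) sc /=.
  by rewrite -z2 (perm_all _ (perm_map snd PZ)) /= in xw.
apply: pcover_perm cA'; apply: (@perm_trans _ (In ++ [:: (s, b), (a, u) & Z])).
  apply: (@perm_trans _ ([:: (a, u); (s, b)] ++ In ++ Z)); last by perm_solve.
  by rewrite /= !perm_cons.
by rewrite perm_cat2l.
Qed.

(** A pair of demands of a piece, dropped from the demands, still has its two
    vertices on the paths of the others: on one path, which it splits leaving a
    gap between two vertices of opposite colours, or on two paths, in which it
    leaves gaps between two white and between two black vertices. *)
Lemma drop_pair j s t L :
  c s = j -> c t = j -> demand col ((s, t) :: L) -> pcover e (piece j) L ->
  (exists a b L' u v, [/\ perm_eq L ((a, b) :: L'), col v = ~~ col u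
     & pcover e (piece j) [:: (s, t), (a, u), (v, b) & L']]) \/
  (exists a b a' b' L' u v u' v',
     [/\ perm_eq L [:: (a, b), (a', b') & L'], e u s /\ e s v, e u' t /\ e t v'
       & pcover e (piece j)
           [:: (a, u), (s, s), (v, b), (a', u'), (t, t), (v', b') & L']]).
Proof.
move=> sj tj; rewrite demand_cons => /= /and5P[cs ct sL tL dL] cL.
have /and3P[/allP aL _ _] := dL.
have sA : s \in piece j by rewrite inE sj.
have tA : t \in piece j by rewrite inE tj.
have [a [b [D [P [sa|[u eus c1]]]]]] := pcover_split cL sA.
  by move: sL; rewrite (perm_mem (perm_map fst P)) /= sa mem_head.
have /andP[/= ca cb] : col a && ~~ col b.
  by apply: (aL (a, b)); rewrite (perm_mem P) mem_head.
have DL d : d \in D -> d \in L by rewrite (perm_mem P) inE => ->; rewrite orbT.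
have [a' [b' [D2 [P2 alt]]]] := pcover_split c1 tA.
have ab' : (a', b') \in [:: (a, u), (s, b) & D] by rewrite (perm_mem P2) mem_head.
have ta : t != a'.
  rewrite eq_sym; apply: (@col_neq V col) => //.
  move: ab'; rewrite !inE => /or3P[/eqP[-> _] //|/eqP[-> _] //|/DL/aL/andP[]] //.
case: alt => [tE|[w ewt c2]]; first by move: ta; rewrite tE eqxx.
move: ab'; rewrite !inE => /or3P[/eqP[aE bE]|/eqP[aE bE]|D3]; last first.
- have {D3} P3 := perm_to_rem D3; set D3 := rem _ D in P3.
  have {}c2 : pcover e (piece j) [:: (t, b'), (a', w), (a, u), (s, b) & D3].
    apply: pcover_perm c2.
    apply: (@perm_trans _ [:: (t, b'), (a', w) & D2]); first by perm_solve.
    rewrite !perm_cons -(perm_cons (a', b')) -(permPl P2).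
    apply: (@perm_trans _ ([:: (a, u); (s, b)] ++ (a', b') :: D3)).
      by rewrite /= !perm_cons.
    perm_solve.
  have tb : t != b'.
    apply: contraNneq tL => ->.
    by apply: (map_f snd (x := (a', b'))); rewrite DL // (perm_mem P3) mem_head.
  have [v' etv c3] := pcover_first_edge tb c2.
  have {}c3 : pcover e (piece j)
      [:: (s, b), (t, t), (v', b'), (a', w), (a, u) & D3].
    by apply: pcover_perm c3; perm_solve.
  have [v esv c4] := pcover_first_edge (col_neq cs cb) c3.
  right; exists a, b, a', b', D3, u, v, w, v'; split=> //.
    by rewrite (permPl P) perm_cons.
  by apply: pcover_perm c4; perm_solve.
- move: P2 c2; rewrite aE bE => P2 c2.
  have {}c2 : pcover e (piece j) [:: (t, b), (s, w), (a, u) & D].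
    apply: pcover_perm c2.
    apply: (@perm_trans _ [:: (t, b), (s, w) & D2]); first by perm_solve.
    by rewrite !perm_cons -(perm_cons (s, b)) -(permPl P2); perm_solve.
  have tb : t != b.
    apply: contraNneq tL => ->.
    by apply: (map_f snd (x := (a, b))); rewrite (perm_mem P) mem_head.
  have [v etv c3] := pcover_first_edge tb c2.
  have {}c3 : pcover e (piece j) [:: (s, w), (t, t), (a, u), (v, b) & D].
    by apply: pcover_perm c3; perm_solve.
  left; exists a, b, D, u, v; split=> //; last exact: (pcover_join ewt c3).
  by rewrite (ecol etv) ct (edge_col eus) cs.
- move: P2 c2; rewrite aE bE perm_cons => P2 c2.
  have {}c2 : pcover e (piece j) [:: (s, b), (a, w), (t, u) & D].
    apply: pcover_perm c2.
    apply: (@perm_trans _ [:: (a, w), (t, u), (s, b) & D]); last by perm_solve.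
    by rewrite !perm_cons perm_sym.
  have [v esv c3] := pcover_first_edge (col_neq cs cb) c2.
  have {}c3 : pcover e (piece j) [:: (t, u), (s, s), (a, w), (v, b) & D].
    by apply: pcover_perm c3; perm_solve.
  left; exists a, b, D, w, v; split=> //.
    by rewrite (ecol esv) cs (edge_col ewt) ct.
  by apply: (pcover_rev esym); apply: (pcover_join eus c3).
Qed.

(** ** All pairs meet one piece, none of them with its white vertex alone *)

Lemma mem_outer (j1 j : I) : j \in J0 -> j != j1 -> j \in J0 :\ j1.
Proof. by move=> jJ jj; rewrite !inE jj. Qed.

(** A gap in a path of the piece [j1] whose ends have different colours is closed
    by a Hamiltonian path of a piece [j] that is otherwise untouched. *)
Lemma close_gap j1 j a b u v L R :
  j1 \in J0 -> j \in J0 -> j != j1 ->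
  pcover e (piece j1) [:: (a, u), (v, b) & L] -> col v = ~~ col u ->
  demand col R -> ends_in (union (J0 :\ j1)) R ->
  (forall i, i \in J0 :\ j1 -> load i R <= K) -> load j R = 0 ->
  pcover e (union J0) ((a, b) :: L ++ R).
Proof.
move=> j1J jJ jj1 c1 cuv dR eR lR lj.
have /= /and3P[/andP[_ /eqP uj] /andP[/eqP vj _] _] := piece_ends c1.
have link x y : c x = j1 -> c y = j1 -> ~~ col x -> col y ->
    pcover e (union (J0 :\ j1)) ((nb j x, nb j y) :: R).
  move=> xj yj cx cy.
  have nx : c (nb j x) = j by apply: nbc; rewrite ?xj // eq_sym.
  have ny : c (nb j y) = j by apply: nbc; rewrite ?yj // eq_sym.
  have [x1 _] := load0_notin lj nx; have [_ y2] := load0_notin lj ny.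
  apply: route => //; first exact: subsetDl.
  - rewrite demand_cons /= x1 y2 dR !nb_col ?xj ?yj ?cx ?cy //;
    by rewrite eq_sym.
  - by rewrite /ends_in /= inE nx inE ny mem_outer.
  - move=> i iJ; rewrite /load /= /touch /= nx ny orbb.
    by case: eqP => [<-|_]; [rewrite -/(load j R) lj; exact: Kpos | exact: lR].
have jJ' := mem_outer jJ jj1.
have enb x : c x = j1 -> e x (nb j x) by move=> xj; apply: nbe; rewrite ?xj // eq_sym.
have cl : pcover e (union (J0 :\ j1)) ((nb j u, nb j v) :: R).
  case cu : (col u) cuv => /= cv.
    by apply: (pcover_rev esym); apply: link; rewrite ?cv.
  by apply: link; rewrite ?cu ?cv.
have cA := pcover_addD j1J c1 cl.
have {}cA : pcover e (union J0) [:: (a, u), (nb j u, nb j v), (v, b) & L ++ R].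
  by apply: pcover_perm cA; perm_solve.
by have /pcover_join := pcover_join (enb u uj) cA; apply; rewrite esym enb.
Qed.

End Weld.

Section Overload.
Variables (V : finType) (e : rel V) (I : finType) (c : V -> I).

Notation piece j := [set x | c x == j].
Notation union J := [set x | c x \in J].
Variables (col : pred V) (nb : I -> V -> V) (J0 : {set I}) (K : nat).
Hypothesis W : welded e c col nb J0 K.

Let esym : symmetric e := weld_sym W.
Let ecol := weld_col W.
Let nbc := weld_nbc W.
Let nbe := weld_nbe W.
Let nbI := weld_nbI W.
Let Kpos := weld_pos W.
Let plink := weld_linked W.
Let pcard := weld_card W.
Notation load := (load c).
Notation touch := (touch c).

Lemma nbP j x :
  j \in J0 -> c x \in J0 -> c x != j ->
  [/\ c (nb j x) = j, col (nb j x) = ~~ col x, e x (nb j x) & e (nb j x) x].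
Proof.
by move=> jJ xJ xj; rewrite nbc // (nb_col W) // nbe // esym nbe.
Qed.

Lemma neq_piece x y : c x != c y -> x != y.
Proof. by apply: contra_neq => ->. Qed.

(** All pairs have both ends in [j1], so that all other pieces are available.  The
    pair [(s, t)] is dropped from the demands of [j1].  If this leaves two gaps,
    [(u, v)] with white ends and [(u', v')] with black ends, then the halves of a
    Hamiltonian path of [j4] carry [u] and [u'] over to [j5] with the colours
    needed to reach [v] and [v'], and [j6] joins [s] to [t]. *)
Lemma overload_internal j1 s t L :
  j1 \in J0 -> K.+2 <= #|J0| -> demand col ((s, t) :: L) ->
  ends_in (piece j1) ((s, t) :: L) -> size L = K ->
  pcover e (union J0) ((s, t) :: L).
Proof.
move=> j1J szJ dQ /andP[] /[!inE] /= /andP[/eqP sj /eqP tj] eL szL.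
have dL := dQ; rewrite demand_cons /= in dL; have /and5P[cs ct _ _ {}dL] := dL.
have cL : pcover e (piece j1) L.
  by apply: plink; rewrite ?szL // -size_eq0 szL -lt0n.
case: (drop_pair W sj tj dQ cL) => [[a [b [L' [u [v [P cuv c1]]]]]]|].
  have [|j jJ] := @pick_piece _ J0 [:: j1]; first exact: leq_trans szJ.
  rewrite inE => jj1.
  have {}c1 : pcover e (piece j1) [:: (a, u), (v, b), (s, t) & L'].
    by apply: pcover_perm c1; perm_solve.
  have := @close_gap _ _ _ _ _ _ _ _ W j1 j _ _ _ _ _ [::] j1J jJ jj1 c1 cuv.
  move/(_ isT isT (fun _ _ => isT) erefl); apply: pcover_perm.
  apply: (@perm_trans _ [:: (s, t), (a, b) & L']); first by perm_solve.
  by rewrite perm_cons perm_sym.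
case=> a [b [a' [b' [L' [u [v [u' [v' [P [eus esv] [eut etv] c1]]]]]]]]].
have K2 : 1 < K by rewrite -szL (perm_size P).
have [|j4 j4J] := @pick_piece _ J0 [:: j1]; first exact: leq_trans szJ.
rewrite inE => j41.
have [|j5 j5J] := @pick_piece _ J0 [:: j1; j4]; first exact: leq_trans szJ.
rewrite !inE negb_or => /andP[j51 j54].
have [|j6 j6J] := @pick_piece _ J0 [:: j1; j4; j5].
  by apply: leq_trans szJ; rewrite !ltnS.
rewrite !inE !negb_or => /and3P[j61 j64 j65].
have cu : col u = false by rewrite (edge_col W eus) cs.
have cv : col v = false by rewrite (ecol esv) cs.
have cu' : col u' = true by rewrite (edge_col W eut) ct.
have cv' : col v' = true by rewrite (ecol etv) ct.
have /= := piece_ends W c1.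
case/and5P=> /andP[_ /eqP uj] _ /andP[/eqP vj _] /andP[_ /eqP uj'].
move=> /and3P[_ /andP[/eqP vj' _] _].
have out j x : j \in J0 -> j != j1 -> c x = j1 ->
    [/\ c (nb j x) = j, col (nb j x) = ~~ col x, e x (nb j x) & e (nb j x) x].
  by move=> jJ jj xj; apply: nbP; rewrite ?xj // eq_sym.
have [u4 cu4 eu4 _] := out j4 u j4J j41 uj.
have [u4' cu4' eu4' _] := out j4 u' j4J j41 uj'.
have [v5 cv5 _ ev5] := out j5 v j5J j51 vj.
have [v5' cv5' _ ev5'] := out j5 v' j5J j51 vj'.
have [s6 cs6 es6 _] := out j6 s j6J j61 sj.
have [t6 ct6 _ et6] := out j6 t j6J j61 tj.
have [||f [g [[fj gj] [cf cg] f5n g5n c4]]] :=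
  ham_cut W (F1 := [:: nb j5 v']) (F2 := [:: nb j5 v]) j4J j5J j5J j54 j54 u4 u4'.
- by rewrite cu4 cu4' cu cu'.
- by move: K2; clear; rewrite /=; lia.
rewrite inE in f5n; rewrite inE in g5n.
have f4 : c f != j5 by rewrite fj eq_sym.
have g4 : c g != j5 by rewrite gj eq_sym.
have [|//|f5 cf5 ef5 _] := @nbP j5 f j5J; first by rewrite fj.
have [|//|g5 cg5 eg5 _] := @nbP j5 g j5J; first by rewrite gj.
have c5 : pcover e (union (J0 :\ j1 :\ j4))
    [:: (nb j5 v, nb j5 f); (nb j5 g, nb j5 v'); (nb j6 t, nb j6 s)].
  apply: (route W) => //.
  - exact: subset_trans (subsetDl _ _) (subsetDl _ _).
  - rewrite !demand_cons /= !inE !negb_or /= cv5 cf5 cg5 cv5' ct6 cs6 cf cg cu4 cu4'.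
    rewrite cu cv cu' cv' cs (negbTE ct) /= f5n eq_sym g5n /= !andbT.
    by rewrite !neq_piece // ?v5 ?t6 ?f5 ?s6 ?g5 ?v5' eq_sym.
  - by rewrite /ends_in /= !inE v5 f5 g5 v5' t6 s6 j54 j51 j5J j64 j61 j6J.
  - move=> i _; rewrite /load /= /touch /= v5 f5 g5 v5' t6 s6 !orbb.
    case: (j5 =P i) => [<-|_]; first by rewrite (negbTE j65).
    by case: (j6 =P i) => _ //=; rewrite ltnW.
have j4J' : j4 \in J0 :\ j1 by rewrite !inE j41.
have cA := pcover_addD j1J c1 (pcover_addD j4J' c4 c5).
join cA eu4. turn cA esym (nb j5 v). join cA ef5. join cA ev5.
turn cA esym g. join cA eu4'. join cA eg5. join cA ev5'.
turn cA esym (nb j6 t). join cA es6. join cA et6.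
apply: pcover_perm cA.
apply: (@perm_trans _ [:: (s, t), (a, b), (a', b') & L']); first by perm_solve.
by rewrite perm_cons perm_sym.
Qed.

(** ** Leaving the overloaded piece through free exits *)

(** The exit paired with [t] enters the piece of [t] directly. *)
Definition entries (es ts : seq V) := [seq nb (c p.2) p.1 | p <- zip es ts].

Lemma entriesP j1 es ts :
  size es = size ts -> j1 \in J0 -> all (fun x => c x == j1) es ->
  all (predC col) es -> all (fun t => c t \in J0 :\ j1) ts ->
  [/\ size (entries es ts) = size ts, all2 e es (entries es ts),
      all col (entries es ts), map c (entries es ts) = map c ts
    & uniq es -> uniq (entries es ts)].
Proof.
move=> + j1J; elim: es ts => [|x es IH] [|t ts] //= [sz].
move=> /andP[/eqP xj ej] /andP[xw ew] /andP[tJ tsJ].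
have [h1 h2 h3 h4 h5] := IH ts sz ej ew tsJ.
have := tJ; rewrite in_setD1 => /andP[tj1 tJ0].
have [|||nj nc en _] := @nbP (c t) x => //; rewrite ?xj // 1?eq_sym //.
split; rewrite /= -/(entries es ts) ?h1 ?en ?nc ?xw ?nj ?h4 //.
move=> /andP[xes /h5 ->]; rewrite andbT; apply: contra xes.
case/mapP=> -[x' t'] xt' /= nE.
have x'e : x' \in es.
  by rewrite -(@unzip1_zip _ _ es ts) ?sz //; apply: (map_f fst xt').
have t'e : t' \in ts.
  by rewrite -(@unzip2_zip _ _ es ts) ?sz //; apply: (map_f snd xt').
have x'j := eqP (allP ej _ x'e).
have := allP tsJ _ t'e; rewrite in_setD1 => /andP[t'j t'J].
have [|||nj' _ _ _] := @nbP (c t') x' => //; rewrite ?x'j // 1?eq_sym //.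
have tt' : c t = c t' by rewrite -nj nE.
suff -> : x = x' by [].
by apply: (nbI tJ0); rewrite ?xj ?x'j // 1?eq_sym // nE tt'.
Qed.

Lemma load_zip j zs ts :
  map c zs = map c ts -> load j (zip zs ts) = count (fun t => c t == j) ts.
Proof.
elim: zs ts => [|z zs IH] [|t ts] //= [zt /IH].
by rewrite /load /= /touch /= zt orbb => ->.
Qed.

Lemma ends_in_zip (J : {set I}) zs ts :
  map c zs = map c ts -> all (fun t => c t \in J) ts -> ends_in (union J) (zip zs ts).
Proof.
elim: zs ts => [|z zs IH] [|t ts] //= [zt zts] /andP[tJ tsJ].
by rewrite /ends_in /= !inE zt tJ; apply: IH.
Qed.

Lemma exits_ends j1 In ss es :
  size ss = size es -> pcover e (piece j1) (In ++ zip ss es) ->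
  all (fun x => c x == j1) es /\ uniq es.
Proof.
move=> sz cA; have [u2 _] := pcover_unzip2 esym cA.
have zE : map snd (zip ss es) = es by apply: unzip2_zip; rewrite sz.
move: u2; rewrite /unzip2 map_cat cat_uniq zE => /and3P[_ _ ->]; split=> //.
apply/allP=> x; rewrite -{1}zE => /mapP[d dz ->].
have := allP (piece_ends W cA) d; rewrite mem_cat dz orbT => /(_ isT).
by case/andP.
Qed.

(** No reserved vertices stand in the way of the exits: distinct white exits have
    distinct black neighbours, and outside [j1] only white vertices are ends. *)
Lemma exits_route j1 In ss es ts :
  j1 \in J0 -> size ss = size es -> size es = size ts -> ts != [::] ->
  all (predC col) es -> all (predC col) ts -> uniq ts ->
  all (fun t => c t \in J0 :\ j1) ts ->
  (forall j, j \in J0 :\ j1 -> count (fun t => c t == j) ts <= K) ->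
  pcover e (piece j1) (In ++ zip ss es) -> pcover e (union J0) (In ++ zip ss ts).
Proof.
move=> j1J sz1 sz2 ts0 ew tw ut tJ lt cA.
have [ej ue] := exits_ends sz1 cA.
have [szz eez zc zct /(_ ue) uz] := entriesP sz2 j1J ej ew tJ.
set zs := entries es ts in szz eez zc zct uz.
have cz : pcover e (union (J0 :\ j1)) (zip zs ts).
  apply: (route W).
  - exact: subsetDl.
  - by rewrite -size_eq0 size_zip szz minnn size_eq0.
  - by rewrite demand_zip // zc tw uz ut.
  - exact: ends_in_zip.
  - by move=> j jJ; rewrite load_zip // lt.
have {cA}cz := pcover_addD j1J cA cz.
have {}cz : pcover e (union J0) (zip ss es ++ zip zs ts ++ In).
  by apply: pcover_perm cz; perm_solve.
have := pcover_join_zip sz1 _ szz eez cz.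
rewrite szz sz2 => /(_ erefl); apply: pcover_perm; perm_solve.
Qed.

(** A path from [s'] to [t] through the whole piece, cut in front of [s], is at
    the same time a path from [s] to [t] and a path from [s'] to an exit. *)
Lemma overload_two j1 s t s' t' :
  j1 \in J0 -> demand col [:: (s, t); (s', t')] ->
  c s = j1 -> c t = j1 -> c s' = j1 -> c t' \in J0 :\ j1 ->
  pcover e (union J0) [:: (s, t); (s', t')].
Proof.
move=> j1J dQ sj tj sj' tJ'.
move: dQ; rewrite !demand_cons /= !inE => /and5P[cs ct ss' _ /and3P[cs' ct' _]].
have ham : pcover e (piece j1) [:: (s', t)] by apply: (piece_ham W).
have sA : s \in piece j1 by rewrite inE sj.
have [u eus cA] := pcover_ham_split ham sA ss'.
apply: (@exits_route j1 [:: (s, t)] [:: s'] [:: u] [:: t']) => //=.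
- by rewrite (edge_col W eus) cs.
- by rewrite ct'.
- by rewrite tJ'.
- by move=> j _; rewrite addn0; apply: leq_trans (leq_b1 _) Kpos.
by apply: pcover_perm cA; perm_solve.
Qed.

(** With all black ends in [j1] and all white ends in [j2], both pieces are covered
    with free exits.  Their positions are arbitrary, so they are linked through
    other pieces, one pair through [j3] and the other [K] through [j4].  If [K] is
    1 there may be no fourth piece, but then one of the two paths can be led
    through a matching edge [x], [nb j2 x] chosen in advance. *)
Lemma overload_two_pieces j1 j2 ss ts :
  j1 \in J0 -> j2 \in J0 -> j2 != j1 -> K.+2 <= #|J0| ->
  size ss = K.+1 -> size ts = K.+1 -> demand col (zip ss ts) ->
  all (fun x => c x == j1) ss -> all (fun x => c x == j2) ts ->
  pcover e (union J0) (zip ss ts).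
Proof.
move=> j1J j2J j21 szJ szs szt; rewrite demand_zip ?szs // => /and4P[sc tc us ut] sj tj.
have [|j3 j3J] := @pick_piece _ J0 [:: j1; j2]; first exact: leq_trans szJ.
rewrite !inE negb_or => /andP[j31 j32].
have j2J' : j2 \in J0 :\ j1 by rewrite !inE j21.
have sub2 : J0 :\ j1 :\ j2 \subset J0.
  exact: subset_trans (subsetDl _ _) (subsetDl _ _).
have out x j j' : c x = j' -> j' \in J0 -> j \in J0 -> j != j' ->
    [/\ c (nb j x) = j, col (nb j x) = ~~ col x, e x (nb j x) & e (nb j x) x].
  by move=> xj j'J jJ jj; apply: nbP; rewrite ?xj // eq_sym.
have [K1|K1] := leqP K 1.
  have KE : K = 1 by apply/eqP; rewrite eqn_leq K1.
  case: ss ts szs szt sc tc us ut sj tj => [|s1 [|s2 [|? ?]]] [|t1 [|t2 [|? ?]]] //;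
    rewrite ?KE // => _ _ /= /and3P[s1c s2c _] /and3P[t1c t2c _].
  rewrite !inE !andbT => s12 t12 /andP[/eqP s1j /eqP s2j] /andP[/eqP t1j /eqP t2j].
  have [x] : exists x, x \in [set x in piece j1 | col x == false].
    apply/set0Pn; rewrite -card_gt0 -ltnS.
    by have := pcard false j1J; rewrite KE.
  rewrite !inE => /andP[/eqP xj /eqP xw].
  have [x2 cx ex _] := out x j2 j1 xj j1J j2J j21.
  have h1 : pcover e (piece j1) [:: (s1, x)] by apply: (piece_ham W); rewrite ?xw.
  have s2A : s2 \in piece j1 by rewrite inE s2j.
  have [|u eus c1] := pcover_ham_split h1 s2A; first by rewrite eq_sym.
  have h2 : pcover e (piece j2) [:: (t1, nb j2 x)].
    by apply: (pcover_rev esym); apply: (piece_ham W); rewrite ?cx ?xw.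
  have t2A : t2 \in piece j2 by rewrite inE t2j.
  have [|v evt c2] := pcover_ham_split h2 t2A; first by rewrite eq_sym.
  have /= /andP[/andP[_ /eqP uj] _] := piece_ends W c1.
  have /= /andP[/andP[_ /eqP vj] _] := piece_ends W c2.
  have [u3 cu3 eu3 _] := out u j3 j1 uj j1J j3J j31.
  have [v3 cv3 _ ev3] := out v j3 j2 vj j2J j3J j32.
  have c3 : pcover e (union (J0 :\ j1 :\ j2)) [:: (nb j3 u, nb j3 v)].
    apply: (route W) => //.
    - rewrite demand_cons /= cu3 cv3 (edge_col W eus) s2c.
      by rewrite (edge_col W evt) (negbTE t2c).
    - by rewrite /ends_in /= !inE u3 v3 j32 j31 j3J.
    - by move=> i _; rewrite /load /= addn0; apply: leq_trans (leq_b1 _) Kpos.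
  have cA := pcover_addD j1J c1 (pcover_addD j2J' c2 c3).
  turn cA esym t1; join cA eu3; join cA ev3.
  turn cA esym t2; join cA ex.
  by apply: pcover_perm cA; perm_solve.
have [|j4 j4J] := @pick_piece _ J0 [:: j1; j2; j3].
  by apply: leq_trans szJ; rewrite !ltnS.
rewrite !inE !negb_or => /and3P[j41 j42 j43].
have exits (b : pred V) (Wb : welded e c b nb J0 K) j xs : j \in J0 ->
    size xs = K.+1 -> all b xs -> uniq xs -> all (fun x => c x == j) xs ->
    exists es, [/\ size es = K.+1, all (predC b) es,
      pcover e (piece j) (zip xs es), uniq es & all (fun x => c x == j) es].
  case: xs => [//|x xs] jJ /= [szx] xc xu xj.
  case: (@free_exits _ _ _ _ _ _ _ _ Wb j [::] x xs) => //.
    move=> [es [sze ew ces]]; exists es; rewrite -szx; split=> //.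
      by have [] := @exits_ends j [::] (x :: xs) es _ ces.
    by have [] := @exits_ends j [::] (x :: xs) es _ ces.
  move=> [a [b' [In' [u [v [es [/perm_size]]]]]]] //.
have [es [sze ew ces ue ej]] := exits _ W j1 ss j1J szs sc us sj.
have [fs [szf fw cfs uf fj]] := exits _ (welded_flip W) j2 ts j2J szt tc ut tj.
case: es sze ew ces ue ej => [//|e1 es] /= [sze] /andP[e1w ew] ces /andP[e1n ue].
move=> /andP[/eqP e1j ej].
case: fs szf fw cfs uf fj => [//|f1 fs] /= [szf] /andP[f1w fw] cfs /andP[f1n uf].
move=> /andP[/eqP f1j fj]; rewrite negbK in f1w.
have [e13 ce13 ee1 _] := out e1 j3 j1 e1j j1J j3J j31.
have [f13 cf13 _ ef1] := out f1 j3 j2 f1j j2J j3J j32.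
have nbs b j xs : j \in J0 -> j != j4 -> all (fun x => c x == j) xs ->
    all (fun x => col x == b) xs -> uniq xs ->
  [/\ all (fun x => c x == j4) (map (nb j4) xs), uniq (map (nb j4) xs),
      all (fun x => col x == ~~ b) (map (nb j4) xs),
      all2 e xs (map (nb j4) xs) & all2 e (map (nb j4) xs) xs].
  move=> jJ jj; elim: xs => [|x xs IH] //= /andP[/eqP xj xsj] /andP[/eqP xb xsb].
  move=> /andP[xn xsu]; have [h1 h2 h3 h4 h5] := IH xsj xsb xsu.
  have [|||n1 n2 n3 n4] := @nbP j4 x; rewrite ?xj //.
  rewrite n1 n2 xb n3 n4 !eqxx h1 h2 h3 h4 h5; split=> //; rewrite andbT.
  apply: contra xn => /mapP[y yxs nxy].
  suff -> : x = y by [].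
  by apply: (nbI j4J) nxy; rewrite ?xj // (eqP (allP xsj _ yxs)).
have [||e4j e4u e4c e4e _] := nbs false j1 es j1J _ ej _ ue.
- by rewrite eq_sym.
- by apply: sub_all ew => x /= /negbTE ->.
have [||f4j f4u f4c _ f4e] := nbs true j2 fs j2J _ fj _ uf.
- by rewrite eq_sym.
- by apply: sub_all fw => x /=; rewrite negbK => ->.
set es' := map _ es in e4j e4u e4c e4e; set fs' := map _ fs in f4j f4u f4c f4e.
have sze' : size es' = K by rewrite size_map sze.
have szf' : size fs' = K by rewrite size_map szf.
have notin3 x xs : c x = j3 -> all (fun x => c x == j4) xs -> x \notin xs.
  by move=> xj /allP xsj; apply/negP => /xsj; rewrite xj eq_sym (negbTE j43).
have z4 d : d \in zip es' fs' -> c d.1 = j4 /\ c d.2 = j4.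
  case: d => x y xy; split; apply/eqP.
    apply: (allP e4j); rewrite -(@unzip1_zip _ _ es' fs') ?sze' ?szf' //.
    exact: (map_f fst xy).
  apply: (allP f4j); rewrite -(@unzip2_zip _ _ es' fs') ?sze' ?szf' //.
  exact: (map_f snd xy).
have c3 : pcover e (union (J0 :\ j1 :\ j2))
    (zip (nb j3 e1 :: es') (nb j3 f1 :: fs')).
  apply: (route W) => //.
  - rewrite demand_zip /= ?sze' ?szf' // ce13 e1w cf13 f1w e4u f4u !notin3 //= !andbT.
    apply/andP; split; first by apply: sub_all e4c => x /eqP ->.
    by apply: sub_all f4c => x /= /eqP ->.
  - rewrite /ends_in /= !inE e13 f13 j31 j32 j3J /=; apply/allP=> d /z4[d1 d2].
    by rewrite !inE d1 d2 j41 j42 j4J.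
  - move=> i _; rewrite /load /= /touch /= e13 f13 orbb.
    case: (j3 =P i) => [<-|_]; last first.
      by apply: leq_trans (count_size _ _) _; rewrite size_zip sze' szf' minnn.
    rewrite (@eq_in_count _ _ pred0) ?count_pred0 //.
    by move=> d /z4[-> ->]; rewrite orbb (negbTE j43).
have {}cfs := pcover_flip esym cfs.
have fzE : map (@flip V) (zip ts (f1 :: fs)) = zip (f1 :: fs) ts.
  by elim: (ts) (f1 :: fs) => [|? ? IH] [|? ?] //=; rewrite IH.
rewrite fzE in cfs.
have cA := pcover_addD j1J ces (pcover_addD j2J' cfs c3).
have {}cA : pcover e (union J0) (zip ss (e1 :: es) ++
    zip (nb j3 e1 :: es') (nb j3 f1 :: fs') ++ zip (f1 :: fs) ts).
  by apply: pcover_perm cA; perm_solve.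
have := pcover_join_zip _ _ _ _ cA.
rewrite /= szs sze sze' szf' ee1 e4e => /(_ erefl erefl erefl isT) {}cA.
have {}cA : pcover e (union J0) (zip ss (nb j3 f1 :: fs') ++ zip (f1 :: fs) ts ++ [::]).
  by rewrite cats0.
have := pcover_join_zip _ _ _ _ cA.
by rewrite /= szs szt szf szf' ef1 f4e cats0 => /(_ erefl erefl erefl isT).
Qed.

(** The black vertex [s] left out of the demands lies on a path between two
    vertices of the piece.  The gap that it leaves has white ends, while [s] has
    to go on to the white vertex [t].  A cut Hamiltonian path of an untouched
    piece [j4] corrects both parities: one half serves the gap, which is closed
    in another piece [j5], and the other one leads from [s] into the piece of
    [t]. *)
Lemma overload_gap j1 a b u v s t In ss es ts :
  j1 \in J0 -> K.+2 <= #|J0| -> 1 < K ->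
  pcover e (piece j1) ([:: (a, u); (s, s); (v, b)] ++ In ++ zip ss es) ->
  e u s -> e s v -> col s -> ~~ col t -> c t \in J0 :\ j1 ->
  size ss = size es -> size es = size ts -> size ts < K ->
  all (predC col) es -> all (predC col) ts -> uniq (t :: ts) ->
  all (fun t => c t \in J0 :\ j1) ts ->
  pcover e (union J0) ((a, b) :: (s, t) :: In ++ zip ss ts).
Proof.
move=> j1J szJ K1 c1 eus esv cs ct tJ' sz1 sz2 szK ew tw /= /andP[tts ut] tsJ.
have := tJ'; rewrite in_setD1 => /andP[tj1 tJ]; set jb := c t in tj1 tJ.
have [|j4 j4J] := @pick_piece _ J0 [:: j1, jb & map c ts].
  by apply: leq_trans szJ; rewrite /= size_map !ltnS.
rewrite !inE !negb_or => /and3P[j41 j4b j4t].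
have [|j5 j5J] := @pick_piece _ J0 [:: j1; j4; jb].
  by apply: leq_trans szJ; rewrite !ltnS.
rewrite !inE !negb_or => /and3P[j51 j54 j5b].
have cu : col u = false by rewrite (edge_col W eus) cs.
have cv : col v = false by rewrite (ecol esv) cs.
have {}c1 : pcover e (piece j1)
    (((a, u) :: (s, s) :: In) ++ zip (b :: ss) (v :: es)).
  turn c1 esym v; apply: pcover_perm c1; perm_solve.
have [] := exits_ends (_ : size (b :: ss) = size (v :: es)) c1.
  by rewrite /= sz1.
move=> vej vue; have /= /andP[/eqP vj ej] := vej.
have /= /and3P[/andP[_ /eqP uj] /andP[/eqP sj _] _] := piece_ends W c1.
have [|||u4 cu4 eu4 _] := nbP (j := j4) (x := u) => //; rewrite ?uj // 1?eq_sym //.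
have [|||s4 cs4 es4 _] := nbP (j := j4) (x := s) => //; rewrite ?sj // 1?eq_sym //.
have [zz _ _ zp _] := entriesP sz2 j1J ej ew tsJ.
have jb4 : jb != j4 by rewrite eq_sym.
have szF : size ts + size (entries es ts) <= 2 * K.-1.
  by rewrite zz; move: szK; clear; lia.
have [|f [g [[fj gj] [cf cg] f5n gbn c4]]] :=
  ham_cut W j4J j5J tJ j54 jb4 u4 s4 _ szF; first by rewrite cu4 cs4 cu cs.
have [|||f5 cf5 ef5 _] := nbP (j := j5) (x := f) => //; rewrite ?fj // 1?eq_sym //.
have [|||gb cgb egb _] := nbP (j := jb) (x := g) => //; rewrite ?gj // 1?eq_sym //.
have f5w : col (nb j5 f) = false by rewrite cf5 cf cu4 cu.
have sz2' : size (v :: es) = size (nb j5 f :: ts) by rewrite /= sz2.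
have ew' : all (predC col) (v :: es) by rewrite /= cv.
have tw' : all (predC col) (nb j5 f :: ts) by rewrite /= f5w.
have tsJ' : all (fun t => c t \in J0 :\ j1) (nb j5 f :: ts).
  by rewrite /= f5 !inE j51 j5J.
have [szz eez zc zct /(_ vue) uz] := entriesP sz2' j1J vej ew' tsJ'.
have zE : entries (v :: es) (nb j5 f :: ts) = nb j5 v :: entries es ts.
  by rewrite /entries /= f5.
have v5 : c (nb j5 v) = j5 by move: zct; rewrite zE /= f5 => -[].
set zs := entries (v :: es) _ in szz eez zc zct uz zE.
have c5 : pcover e (union (J0 :\ j1 :\ j4)) ((nb jb g, t) :: zip zs (nb j5 f :: ts)).
  have z1 : unzip1 (zip zs (nb j5 f :: ts)) = zs by apply: unzip1_zip; rewrite szz.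
  have z2 : unzip2 (zip zs (nb j5 f :: ts)) = nb j5 f :: ts.
    by apply: unzip2_zip; rewrite szz.
  apply: (route W) => //.
  - exact: subset_trans (subsetDl _ _) (subsetDl _ _).
  - rewrite demand_cons z1 z2 demand_zip // zc uz tw' cgb cg cs4 cs ct zE.
    rewrite !inE !negb_or (negbTE gbn) tts !andbT /= f5n ut !andbT.
    by rewrite !neq_piece // ?gb ?v5 ?f5 // eq_sym.
  - have -> : ends_in (union (J0 :\ j1 :\ j4)) ((nb jb g, t) :: zip zs (nb j5 f :: ts))
       = ends_in (union (J0 :\ j1 :\ j4)) (zip zs (nb j5 f :: ts)).
      by rewrite /ends_in /= !inE gb -/jb jb4 tj1 tJ.
    apply: ends_in_zip => //=; rewrite f5 !inE j51 j54 j5J /=.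
    apply/allP=> x xts; have := allP tsJ _ xts; rewrite !inE => ->; rewrite andbT.
    by apply: contraNneq j4t => <-; apply: map_f.
  - move=> i _; rewrite /load /= -/(load i _) load_zip //=.
    rewrite /touch /= gb orbb f5.
    apply: leq_trans szK; rewrite -add1n addnA leq_add ?count_size //.
    by rewrite v5 orbb; case: (jb =P i) => [<-|_]; rewrite ?(negbTE j5b) ?leq_b1.
have j4J' : j4 \in J0 :\ j1 by rewrite !inE j41.
have cA := pcover_addD j1J c1 (pcover_addD j4J' c4 c5).
have {}cA : pcover e (union J0) (zip (b :: ss) (v :: es) ++ zip zs (nb j5 f :: ts) ++
   [:: (a, u), (s, s), (nb j4 u, f), (g, nb j4 s), (nb jb g, t) & In]).
  by apply: pcover_perm cA; perm_solve.
have szbv : size (b :: ss) = size (v :: es) by rewrite /= sz1.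
have {cA}/= cA := pcover_join_zip szbv (etrans sz2' (Logic.eq_sym szz)) szz eez cA.
turn cA esym b; join cA eu4; join cA ef5.
turn cA esym g; join cA es4; join cA egb.
by apply: pcover_perm cA; perm_solve.
Qed.

Lemma overload_black j1 Q :
  j1 \in J0 -> K.+2 <= #|J0| -> size Q = K.+1 -> demand col Q ->
  ends_in (union J0) Q -> all (fun d => c d.1 == j1) Q -> pcover e (union J0) Q.
Proof.
move=> j1J szJ szQ dQ eQ Q1.
pose In := [seq d <- Q | c d.2 == j1]; pose X := [seq d <- Q | c d.2 != j1].
have P : perm_eq (In ++ X) Q by rewrite perm_filterC.
have InQ d : d \in In -> d \in Q /\ c d.2 = j1.
  by rewrite mem_filter => /andP[/eqP].
have XQ d : d \in X -> d \in Q /\ c d.2 \in J0 :\ j1.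
  rewrite mem_filter => /andP[dj dQ']; split=> //; rewrite in_setD1 dj.
  by have := allP eQ d dQ'; rewrite !inE => /andP[].
have eI : ends_in (piece j1) In.
  by apply/allP=> d /InQ[/(allP Q1) d1 d2]; rewrite !inE d1 d2 eqxx.
apply: pcover_perm (P) _.
have := dQ; rewrite -(demand_perm _ P) => dP.
have dI : demand col In by apply: demand_filter.
have dX : demand col X by apply: demand_filter.
have szP : size In + size X = K.+1 by rewrite -size_cat (perm_size P).
move: dP szP XQ dX; case: X P => [|[s t] X] P dP szP XQ dX.
  rewrite cats0; rewrite cats0 in dP; rewrite addn0 in szP.
  case: In szP dP eI {P InQ dI} => [//|[s t] L] [szL] dL eL.
  exact: overload_internal dL eL szL.
have sX : X = zip (unzip1 X) (unzip2 X) by rewrite zip_unzip.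
set ss := unzip1 X in sX; set ts := unzip2 X in sX.
have szst : size ss = size ts by rewrite !size_map.
have /and3P[aX uX1 uX2] := dX.
have ssc : all col (s :: ss).
  by apply/allP=> x /(mapP (s := (s, t) :: X))[d dX' ->]; have /andP[] := allP aX d dX'.
have tsc : all (predC col) (t :: ts).
  by apply/allP=> x /(mapP (s := (s, t) :: X))[d dX' ->]; have /andP[] := allP aX d dX'.
have ssj : all (fun x => c x == j1) (s :: ss).
  apply/allP=> x /(mapP (s := (s, t) :: X))[d /XQ[dX' _] ->].
  exact: (allP Q1).
have tsJ : all (fun x => c x \in J0 :\ j1) (t :: ts).
  by apply/allP=> x /(mapP (s := (s, t) :: X))[d /XQ[_ ?] ->].
have u1 : uniq (unzip1 In ++ s :: ss).
  by have /and3P[_ + _] := dP; rewrite /unzip1 map_cat.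
have szIX : size In + size ss = K.
  by apply/eqP; rewrite -eqSS -szP /= addnS size_map.
case: (free_exits W j1J dI eI ssc ssj u1 szIX) => [[es [sze ew cA]]|].
  have szt : size (t :: ts) = size es by rewrite sze /= szst.
  have XE : (s, t) :: X = zip (s :: ss) (t :: ts) by rewrite /= -sX.
  have [[I0 tj]|] : (In = [::] /\ all (fun x => c x == c t) (t :: ts)) \/
      (forall j, count (fun x => c x == j) (t :: ts) <= K).
  - case: (In =P [::]) => [I0|/eqP]; last first.
      rewrite -size_eq0 -lt0n => I1; right=> j; apply: leq_trans (count_size _ _) _.
      by rewrite -szIX /= szst -add1n leq_add2r.
    case: (boolP (all (fun x => c x == c t) (t :: ts))) => tj; first by left.
    right=> j; rewrite -ltnS.
    have szts : size (t :: ts) = K.+1 by rewrite -szIX I0 /= szst.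
    rewrite -szts ltn_neqAle count_size andbT -all_count.
    apply: contra tj => /allP tj; apply/allP=> x /tj /eqP ->.
    by rewrite eq_sym; apply: tj; apply: mem_head.
  - have /andP[+ _] := tsJ; rewrite in_setD1 => /andP[tj1 tJ].
    move: dP; rewrite I0 XE => dP.
    apply: (overload_two_pieces j1J tJ tj1 szJ) => //.
      by rewrite -szIX I0.
    by rewrite szt sze -szIX I0.
  by move=> lt; rewrite XE; apply: exits_route cA => //; rewrite ?sze.
case=> a [b [In' [u [v [es [PI [eus esv] sze ew c1]]]]]].
have szI := perm_size PI; rewrite /= in szI.
have [K1|K1] := leqP K 1.
  have [ss0 In0] : size ss = 0 /\ size In' = 0.
    by move: K1; rewrite -szIX szI addSn ltnS leqn0 addn_eq0 => /andP[/eqP -> /eqP ->].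
  have InE : In = [:: (a, b)].
    by apply: perm_small_eq; rewrite // (size0nil In0) in PI *.
  have X0 : X = [::] by apply: size0nil; rewrite -ss0 size_map.
  move: dP eI ssj tsJ; rewrite InE X0 /= => dP.
  rewrite /ends_in /= !inE andbT => /andP[/eqP aj /eqP bj].
  move=> /andP[/eqP sj _] /andP[tJ _].
  by apply: (overload_two j1J dP aj bj sj); rewrite in_setD1.
have /= /andP[sc _] := ssc; have /= /andP[tc tw] := tsc.
have /= /andP[tJ tsJ'] := tsJ.
have szK : size ts < K by rewrite -szst -szIX szI addSn ltnS leq_addl.
have := overload_gap j1J szJ K1 c1 eus esv sc tc tJ (Logic.eq_sym sze).
rewrite sze => /(_ ts szst szK ew tw uX2 tsJ'); rewrite -sX; apply: pcover_perm.
apply: (@perm_trans _ (((a, b) :: In') ++ (s, t) :: X)); first by perm_solve.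
by rewrite perm_cat2r perm_sym.
Qed.

(** ** Both kinds of crossing pairs meet the overloaded piece *)

(** A pair touching [j1] touches at most one further piece. *)
Lemma sum_load (J : {set I}) j1 D :
  j1 \notin J -> all (touch j1) D -> \sum_(j in J) load j D <= size D.
Proof.
move=> j1J; elim: D => [|d D IH] /=; first by rewrite big1.
move=> /andP[dj /IH{}IH]; rewrite big_split /= -add1n leq_add //.
have [k kP] : exists k, forall j, j \in J -> touch j d -> j = k.
  move: dj; rewrite /touch => /orP[] /eqP dj; [exists (c d.2)|exists (c d.1)];
  by move=> j jJ /orP[] /eqP // jE; move: j1J; rewrite -dj jE jJ.
rewrite (bigID (pred1 k)) /= [X in _ + X]big1 => [|j /andP[jJ jk]]; last first.
  by case: (boolP (touch j d)) => // /(kP j jJ) jE; rewrite jE eqxx in jk.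
rewrite addn0; apply: (@leq_trans (\sum_(j | j == k) 1)); last by rewrite big_pred1_eq.
rewrite [X in _ <= X](bigID (mem J)) /=.
rewrite (eq_bigl (fun j => (j == k) && (j \in J))) => [|j]; last by rewrite andbC.
by apply: leq_trans (leq_addr _ _); apply: leq_sum => j _; apply: leq_b1.
Qed.

Lemma touch_once (J : {set I}) j1 D :
  j1 \notin J -> all (touch j1) D -> size D <= #|J| ->
  (forall j, j \in J -> 0 < load j D) -> forall j, j \in J -> load j D = 1.
Proof.
move=> j1J aD szJ pos j jJ; apply/eqP; rewrite eqn_leq pos // andbT.
have := leq_trans (sum_load j1J aD) szJ.
rewrite (bigD1 j) //= (cardsD1 j) jJ.
have : #|J :\ j| <= \sum_(i in J | i != j) load i D.
  rewrite -sum1_card (eq_bigl (fun i => (i \in J) && (i != j))) => [|i].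
    by apply: leq_sum => i /andP[/pos].
  by rewrite !inE andbC.
set m := #|_|; set k := \sum_(_ in _ | _) _; set l := load _ _.
by clearbody m k l; clear; lia.
Qed.

(** The demand [(s1, t2)] lies in [j1] and replaces two pairs touching [j1], so that
    [j1] can meet it along with the rest.  Cutting its path behind [s1], that is
    between [s1] and the white vertex [v], requires to continue from the black [s1]
    to the white [t1] and from [v] to the black [s2]: both times the colours of the
    neighbours in other pieces are wrong for a single path.

    If [t1] and [s2] lie in the piece [jb] and all other pairs touch it too, then
    [jb] meets the demand [(s2, t1)], and a cut of this path corrects both
    parities.  If some piece [j4] is untouched, a cut Hamiltonian path of [j4] does
    so.  Otherwise every piece but [j1] is touched once, and the Hamiltonian path
    of [jb] from [nb jb v] to [t1] is cut at [nb jb s1]. *)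
Lemma overload_mixed j1 s1 t1 s2 t2 Q :
  j1 \in J0 -> K.+2 <= #|J0| -> (size Q).+1 = K ->
  demand col [:: (s1, t1), (s2, t2) & Q] ->
  ends_in (union J0) [:: (s1, t1), (s2, t2) & Q] ->
  c s1 = j1 -> c t2 = j1 -> c t1 != j1 -> c s2 != j1 -> all (touch j1) Q ->
  pcover e (union J0) [:: (s1, t1), (s2, t2) & Q].
Proof.
move=> j1J szJ szQ dQ eQ s1j t2j t1j s2j tQ.
move: (dQ) (eQ); rewrite !demand_cons /ends_in /= !inE !negb_or s1j t2j.
move=> /and5P[s1c t1c /andP[s12 s1Q] /andP[t12 t1Q] /and5P[s2c t2c s2Q t2Q dQ0]].
move=> /andP[/andP[_ t1J] /andP[/andP[s2J _] eQ0]].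
set jb := c t1 in t1j t1J; set jc := c s2 in s2j s2J.
(* The pair [(s2, t1)] keeps [s2] and [t1] from being used as crossing points. *)
have dN : demand col ([:: (s1, t2); (s2, t1)] ++ Q).
  by rewrite /= !demand_cons /= !inE !negb_or s1c t2c s12 s1Q eq_sym t12 t2Q s2c t1c s2Q t1Q.
have lQ j : load j Q <= K.-1 by rewrite -szQ count_size.
have [||R [dR iR lR cR]] := expand W (subxx J0) dN.
- by rewrite /ends_in /= !inE s1j t2j j1J s2J t1J.
- move=> j jJ; rewrite /load /= /touch /= s1j t2j orbb -/jb -/jc -/(load j Q).
  apply: (@leq_trans (1 + K.-1)); last by rewrite add1n prednK.
  rewrite addnA leq_add //.
  by case: (j1 =P j) => [<-|_]; rewrite ?(negbTE s2j) ?(negbTE t1j) ?leq_b1.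
pose R1 := [seq d <- R | c d.1 == j1]; pose R2 := [seq d <- R | c d.1 != j1].
have {}cR : pcover e (union J0) ([:: (s1, t1); (s2, t2)] ++ R1 ++ R2) ->
    pcover e (union J0) [:: (s1, t1), (s2, t2) & Q].
  move=> cA; apply: (cR _ [:: (s1, t1); (s2, t2)]); apply: pcover_perm cA.
  by rewrite perm_cat2l perm_filterC.
have lR1 j : load j R1 <= load j R by apply: leq_count_subseq; apply: filter_subseq.
have lR2 j : load j R2 <= load j R by apply: leq_count_subseq; apply: filter_subseq.
have iR2 d : d \in R2 -> [/\ c d.1 = c d.2, c d.1 \in J0, c d.1 != j1 & d \in R].
  by rewrite mem_filter => /andP[dj dR']; have /andP[/eqP] := allP iR d dR'.
have R20 j d : load j R = 0 -> d \in R2 -> c d.1 != j.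
  move=> l0 d2; apply/eqP => dj.
  by have [/negP[]] := load0_notin l0 dj; apply: map_f; have [] := iR2 d d2.
have dR1 : demand col ((s1, t2) :: R1).
  have := demand_filter (fun d => c d.1 == j1) dR.
  by rewrite /= s1j eqxx -/jc (negbTE s2j).
have dR2 : demand col ((s2, t1) :: R2).
  have := demand_filter (fun d => c d.1 != j1) dR.
  by rewrite /= s1j eqxx -/jc s2j.
have sR1 : size R1 <= K.-1.
  apply: leq_trans (lQ j1); rewrite -lR size_filter; apply: sub_count => d /= dj.
  by rewrite /touch dj.
have c1 : pcover e (piece j1) ((s1, t2) :: R1).
  apply: plink => //; first by rewrite /= -(prednK Kpos) ltnS.
  rewrite /ends_in /= !inE s1j t2j eqxx; apply/allP=> d.
  rewrite mem_filter !inE => /andP[dj dR']; have /andP[/eqP <- _] := allP iR d dR'.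
  by rewrite dj.
have [v esv {}c1] := pcover_first_edge (col_neq s1c t2c) c1.
have /= /and3P[_ /andP[/eqP vj _] _] := piece_ends W c1.
have cv : col v = false by rewrite (ecol esv) s1c.
have out x j j' : c x = j' -> j' \in J0 -> j \in J0 -> j != j' ->
    [/\ c (nb j x) = j, col (nb j x) = ~~ col x, e x (nb j x) & e (nb j x) x].
  by move=> xj j'J jJ jj; apply: nbP; rewrite ?xj // eq_sym.
have jbJ' : jb \in J0 :\ j1 by rewrite in_setD1 t1j.
have [/andP[/eqP bc lbK]|nover] := boolP ((jb == jc) && (K <= (load jb Q).+1)).
  have Qb : all (touch jb) Q.
    by rewrite all_count eqn_leq count_size -ltnS szQ.
  have R2b d : d \in R2 -> c d.1 = jb.
    move=> d2; have [dd dJ dj dR'] := iR2 d d2; apply/eqP/negPn/negP => db.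
    have l0 : load (c d.1) R = 0.
      rewrite lR; apply/eqP; rewrite -leqn0 leqNgt -has_count; apply/hasPn => d' d'Q.
      have /orP := allP Qb d' d'Q; have /orP := allP tQ d' d'Q.
      rewrite /touch => -[] /eqP d1 [] /eqP d2';
        rewrite ?d1 ?d2' negb_or eq_sym ?dj ?(eq_sym jb) ?db ?(eq_sym j1) ?dj //.
      + by move: t1j; rewrite -d2' d1 eqxx.
      + by move: t1j; rewrite -d2' d1 eqxx.
    by have := R20 _ d l0 d2; rewrite eqxx.
  have szR2 : size R2 <= K.-1.
    apply: leq_trans (lQ jb); rewrite -lR; apply: leq_trans (lR2 jb).
    suff /eqP -> : load jb R2 == size R2 by [].
    rewrite -all_count; apply/allP=> d /R2b dj.
    by rewrite /touch dj eqxx.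
  have c2 : pcover e (piece jb) ((s2, t1) :: R2).
    apply: plink => //.
      by rewrite /= -(prednK Kpos) ltnS.
    rewrite /ends_in /= !inE -/jb -/jc bc eqxx; apply/allP=> d d2; rewrite !inE.
    by have [<- _ _ _] := iR2 d d2; rewrite -bc (R2b d d2) eqxx.
  have s2b : c s2 = jb by rewrite bc.
  have [|j3 j3J] := @pick_piece _ J0 [:: j1; jb]; first exact: leq_trans szJ.
  rewrite !inE negb_or => /andP[j31 j3b].
  have [v3 cv3 _ ev3] := out v j3 j1 vj j1J j3J j31.
  have [s13 cs13 es13 _] := out s1 j3 j1 s1j j1J j3J j31.
  have sub2 : J0 :\ j1 :\ jb \subset J0.
    exact: subset_trans (subsetDl _ _) (subsetDl _ _).
  (* For [K = 1], [nb jb s1] must lie on the only path of [jb]. *)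
  have [K1|K1] := leqP K 1.
    have KE : K = 1 by apply/eqP; rewrite eqn_leq K1.
    have Q0 : Q = [::] by apply: size0nil; move: szQ; rewrite KE => -[].
    have R0 : R2 = [::].
      by apply: size0nil; apply/eqP; rewrite -leqn0; move: szR2; rewrite KE.
    rewrite R0 in c2.
    have [s1b cs1b es1b _] := out s1 jb j1 s1j j1J t1J t1j.
    have [||g egs c2'] := pcover_ham_split c2 (x := nb jb s1).
    + by rewrite inE s1b.
    + by rewrite eq_sym; apply: (@col_neq V col); rewrite // cs1b s1c.
    have cg : col g by rewrite (edge_col W egs) cs1b s1c.
    have /= /andP[/andP[_ /eqP gb] _] := piece_ends W c2'.
    have [g3 cg3 eg3 _] := out g j3 jb gb t1J j3J j3b.
    have c3 : pcover e (union (J0 :\ j1 :\ jb)) [:: (nb j3 v, nb j3 g)].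
      apply: (route W) => //.
      + by rewrite demand_cons /= cv3 cg3 cv cg.
      + by rewrite /ends_in /= !inE v3 g3 j31 j3b j3J.
      + by move=> i _; rewrite /load /= addn0; apply: leq_trans (leq_b1 _) Kpos.
    have [_ _ _ e3v] := out v j3 j1 vj j1J j3J j31.
    have cA := pcover_addD j1J c1 (pcover_addD jbJ' c2' c3).
    join cA es1b. turn cA esym (nb j3 v). join cA eg3. join cA e3v.
    by apply: cR; rewrite R0; apply: pcover_perm cA; perm_solve.
  have [|j4 j4J] := @pick_piece _ J0 [:: j1; jb; j3].
    by apply: leq_trans szJ; rewrite !ltnS.
  rewrite !inE !negb_or => /and3P[j41 j4b j43].
  have [w esw {}c2] := pcover_first_edge (col_neq s2c t1c) c2.
  have cw : col w = false by rewrite (ecol esw) s2c.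
  have /= /and3P[_ /andP[/eqP wj _] _] := piece_ends W c2.
  have [w3 cw3 _ ew3] := out w j3 jb wj t1J j3J j3b.
  have [v4 cv4 _ ev4] := out v j4 j1 vj j1J j4J j41.
  have [s24 cs24 es24 _] := out s2 j4 jb s2b t1J j4J j4b.
  have c3 : pcover e (union (J0 :\ j1 :\ jb))
      [:: (nb j3 w, nb j3 s1); (nb j4 v, nb j4 s2)].
    apply: (route W) => //.
    + rewrite !demand_cons /= !inE cw3 cs13 cv4 cs24 cw s1c cv s2c /= !andbT.
      by rewrite !neq_piece // ?w3 ?v4 ?s13 ?s24 eq_sym.
    + by rewrite /ends_in /= !inE w3 s13 v4 s24 j31 j3b j3J j41 j4b j4J.
    + move=> i _; rewrite /load /= /touch /= w3 s13 v4 s24 !orbb addn0.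
      case: (j3 =P i) => [<-|_]; first by rewrite (negbTE j43).
      by apply: leq_trans (leq_b1 _) Kpos.
  have cA := pcover_addD j1J c1 (pcover_addD jbJ' c2 c3).
  turn cA esym (nb j3 w). join cA es13. join cA ew3.
  turn cA esym (nb j4 v). join cA es24. join cA ev4.
  by apply: cR; apply: pcover_perm cA; perm_solve.
have bK : load jb Q + (jb == jc) <= K.-1.
  move: nover; case: (jb == jc) => /=; last by rewrite addn0.
  by rewrite -ltnNge addn1 => lK; rewrite -ltnS (prednK Kpos).
have [/existsP[j4 /and3P[j4J j41 /eqP l4]]|] := boolP
    [exists j, [&& j \in J0, j != j1 & load j [:: (s1, t1), (s2, t2) & Q] == 0]].
  move: l4; rewrite /load /= /touch /= s1j t2j -/jb -/jc -/(load j4 Q).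
  move/eqP; rewrite !addn_eq0 !eqb0 !negb_or => /and3P[/andP[_ jb4] /andP[jc4 _]].
  rewrite -lR => /eqP l4.
  have [s14 cs14 es14 _] := out s1 j4 j1 s1j j1J j4J j41.
  have [v4 cv4 _ ev4] := out v j4 j1 vj j1J j4J j41.
  pose F1 := [seq x <- unzip1 ((s2, t1) :: R) | c x == jb].
  pose F2 := [seq x <- unzip2 ((s2, t1) :: R) | c x == jc].
  have szF : size F1 + size F2 <= 2 * K.-1.
    rewrite mul2n -addnn leq_add //.
      have := size_firsts_le c jb R; rewrite lR => l1.
      rewrite /F1 /= -/jc eq_sym; apply: leq_trans bK.
      by case: (jb == jc) => /=; rewrite ?addn1 ?addn0.
    have := size_seconds_le c jc R; rewrite lR => l2.
    rewrite /F2 /= -/jb; case: eqP bK => [->|_ _] /=.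
      by rewrite addn1; apply: leq_trans.
    exact: leq_trans l2 (lQ jc).
  have cab : col (nb j4 v) = ~~ col (nb j4 s1) by rewrite cv4 cs14 cv s1c.
  have [f [g [[fj gj] [cf cg] fn gn c4]]] :=
    ham_cut W j4J t1J s2J jb4 jc4 s14 v4 cab szF.
  have [fb cfb efb _] := out f jb j4 fj j4J t1J jb4.
  have [gc cgc _ egc] := out g jc j4 gj j4J s2J jc4.
  have fbF : nb jb f \notin s2 :: unzip1 R2.
    apply: contra fn => fbin; rewrite mem_filter fb eqxx /=.
    apply: mem_subseq fbin; rewrite /= eqxx.
    exact/map_subseq/filter_subseq.
  have gcF : nb jc g \notin t1 :: unzip2 R2.
    apply: contra gn => gcin; rewrite mem_filter gc eqxx /=.
    apply: mem_subseq gcin; rewrite /= eqxx.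
    exact/map_subseq/filter_subseq.
  have c5 : pcover e (union (J0 :\ j1 :\ j4)) [:: (nb jb f, t1), (s2, nb jc g) & R2].
    apply: (route W) => //.
    + exact: subset_trans (subsetDl _ _) (subsetDl _ _).
    + move: dR2; rewrite !demand_cons /= => /and5P[_ _ -> t1R ->].
      rewrite cfb cf cs14 s1c t1c fbF s2c cgc cg cv4 cv !inE negb_or t1R.
      by move: gcF; rewrite inE negb_or eq_sym => /andP[-> ->].
    + rewrite /ends_in /= !inE fb gc -/jb -/jc jb4 jc4 t1j s2j t1J s2J /=.
      apply/allP=> d d2; have [dd dJ dj _] := iR2 d d2.
      by rewrite !inE -dd dj dJ (R20 j4 d l4 d2).
    + move=> i _; rewrite /load /= /touch /= fb gc -/jb -/jc !orbb -/(load i R2).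
      apply: (@leq_trans ((jb == i) + ((jc == i) + load i Q))).
        by rewrite !leq_add2l -lR.
      rewrite -(prednK Kpos); case: (jb =P i) bK => [<-|_ _].
        by rewrite add1n ltnS addnC eq_sym.
      by rewrite add0n -add1n leq_add ?leq_b1.
  have j4J' : j4 \in J0 :\ j1 by rewrite in_setD1 j41.
  have cA := pcover_addD j1J c1 (pcover_addD j4J' c4 c5).
  join cA es14. join cA efb. join cA egc. join cA ev4.
  by apply: cR; apply: pcover_perm cA; perm_solve.
move=> /existsPn full.
have once j : j \in J0 :\ j1 -> load j [:: (s1, t1), (s2, t2) & Q] = 1.
  apply: (@touch_once _ j1) => //.
  - by rewrite in_setD1 eqxx.
  - by rewrite /= /touch s1j t2j !eqxx orbT.
  - by rewrite /= szQ -ltnS; apply: leq_trans szJ _; rewrite (cardsD1 j1) j1J.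
  - move=> i; rewrite in_setD1 => /andP[ij iJ].
    by have := full i; rewrite iJ ij /= lt0n.
have jcJ' : jc \in J0 :\ j1 by rewrite in_setD1 s2j.
have [jcb lb] : jc != jb /\ load jb R = 0.
  have := once jb jbJ'; rewrite lR /load /= /touch /= s1j t2j -/jb -/jc eqxx orbT.
  rewrite (eq_sym j1) (negbTE t1j) orbF.
  by case: (jc == jb) => //; case: (count _ Q).
have lc : load jc R = 0.
  have := once jc jcJ'; rewrite lR /load /= /touch /= s1j t2j -/jb -/jc eqxx /=.
  rewrite (eq_sym j1) (negbTE s2j) (eq_sym jb) (negbTE jcb) add0n.
  by case: (count _ Q).
have [s1b cs1b es1b _] := out s1 jb j1 s1j j1J t1J t1j.
have [vb cvb _ evb] := out v jb j1 vj j1J t1J t1j.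
have cb : pcover e (piece jb) [:: (nb jb v, t1)].
  by apply: (piece_ham W); rewrite ?cvb ?cv.
have [||g egs {}cb] := pcover_ham_split cb (x := nb jb s1).
- by rewrite inE s1b.
- by rewrite eq_sym; apply: (@col_neq V col); rewrite ?cvb ?cv ?cs1b ?s1c.
have cg : col g by rewrite (edge_col W egs) cs1b s1c.
have /= /andP[/andP[_ /eqP gb] _] := piece_ends W cb.
have [gc cgc _ egc] := out g jc jb gb t1J s2J jcb.
have c5 : pcover e (union (J0 :\ j1 :\ jb)) ((s2, nb jc g) :: R2).
  apply: (route W) => //.
  - exact: subset_trans (subsetDl _ _) (subsetDl _ _).
  - move: dR2; rewrite !demand_cons /= => /and5P[_ _ -> _ ->].
    rewrite s2c cgc cg andbT /=.
    by apply: (load0_notin _ gc).2; apply/eqP; rewrite -leqn0 -lc.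
  - rewrite /ends_in /= !inE gc -/jc jcb s2j s2J /=.
    apply/allP=> d d2; have [dd dJ dj _] := iR2 d d2.
    by rewrite !inE -dd dj dJ (R20 jb d lb d2).
  - move=> i _; rewrite /load /= /touch /= gc -/jc orbb -/(load i R2).
    rewrite -(prednK Kpos) -add1n leq_add ?leq_b1 //.
    by apply: leq_trans (lR2 i) _; rewrite lR.
have cA := pcover_addD j1J c1 (pcover_addD jbJ' cb c5).
join cA es1b. turn cA esym (nb jb v). join cA egc. join cA evb.
by apply: cR; apply: pcover_perm cA; perm_solve.
Qed.

End Overload.

Section WeldLinks.
Variables (V : finType) (e : rel V) (I : finType) (c : V -> I).

Notation piece j := [set x | c x == j].
Notation union J := [set x | c x \in J].
Variables (col : pred V) (nb : I -> V -> V) (J0 : {set I}) (K : nat).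
Hypothesis W : welded e c col nb J0 K.

Let esym : symmetric e := weld_sym W.
Let pcard := weld_card W.
Notation load := (load c).
Notation touch := (touch c).

(** ** A weld links one pair more than its pieces *)

(** If neither all black nor all white ends lie in the overloaded piece, then,
    every pair touching it, there is a pair of each of the two crossing kinds. *)
Lemma weld_links_more : K.+2 <= #|J0| -> linked e col K.+1 (union J0).
Proof.
move=> szJ D D0 szD dD eD.
have [/forall_inP lD|] := boolP [forall j in J0, load j D <= K].
  exact: (route W).
rewrite negb_forall_in => /exists_inP[j1 j1J]; rewrite -ltnNge => lD.
have szE : size D = K.+1.
  by apply/eqP; rewrite eqn_leq szD; apply: leq_trans lD (count_size _ _).
have tD : all (touch j1) D.
  by rewrite all_count eqn_leq count_size szE.
have [b1|/allPn[d dD1 d1]] := boolP (all (fun d => c d.1 == j1) D).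
  exact: (overload_black W j1J).
have [b2|/allPn[d' dD2 d2]] := boolP (all (fun d => c d.2 == j1) D).
  have -> : D = map (@flip V) (map (@flip V) D).
    by rewrite -map_comp map_id_in // => -[].
  apply: (pcover_flip esym); apply: (overload_black (welded_flip W) j1J) => //.
  - by rewrite size_map.
  - have /and3P[aD u1 u2] := dD.
    rewrite /demand /unzip1 /unzip2 -!map_comp u1 u2 !andbT all_map.
    by apply: sub_all aD => x /=; rewrite negbK andbC.
  - by rewrite /ends_in all_map; apply: sub_all eD => x /=; rewrite andbC.
  - by rewrite all_map.
have /orP[] := allP tD d dD1; rewrite ?(negbTE d1) // => d2j.
have /orP[d1j|] := allP tD d' dD2; rewrite ?(negbTE d2) //.
have P1 := perm_to_rem dD1; set D1 := rem d D in P1.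
have d'D1 : d' \in D1.
  move: dD2; rewrite (perm_mem P1) inE => /predU1P[dd|//].
  by rewrite -dd d1j in d1.
have P2 := perm_to_rem d'D1; set Q := rem d' D1 in P2.
have P : perm_eq D [:: d', d & Q].
  by rewrite (permPl P1) (@perm_trans _ [:: d, d' & Q]) ?perm_cons //; perm_solve.
apply: (@pcover_perm _ _ _ [:: d', d & Q]); first by rewrite perm_sym.
clearbody Q; case: d d' {dD1 dD2 P1 P2 D1 d'D1} d1 d2j d2 d1j P.
move=> s2 t2 [s1 t1] /= s2j /eqP t2j t1j /eqP s1j P.
apply: (overload_mixed W j1J) => //.
- by apply/eqP; rewrite -eqSS -szE (perm_size P).
- by rewrite -(demand_perm _ P).
- by rewrite /ends_in -(perm_all _ P).
- by have := tD; rewrite (perm_all _ P) => /and3P[].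
Qed.

Lemma weld_colour_card b :
  (2 * K).-1 * #|J0| <= #|[set x in union J0 | col x == b]|.
Proof.
rewrite -[leqRHS]sum1_card (partition_big c (mem J0)) /= => [|x]; last by rewrite !inE => /andP[].
rewrite mulnC -sum_nat_const leq_sum // => j jJ; rewrite sum1dep_card.
have := pcard b jJ; rewrite -(prednK (_ : 0 < 2 * K)) ?muln_gt0 ?(weld_pos W) // ltnS => cb.
apply: leq_trans cb _; rewrite subset_leq_card //; apply/subsetP=> x; rewrite !inE.
by case/andP=> /eqP -> ->; rewrite jJ eqxx.
Qed.

End WeldLinks.

(** * Welding processes *)

(** The index [None] collects the vertices outside the weld. *)
Lemma weld_welded (V : finType) (e : rel V) (col : pred V) (A : {set V}) l
    (B : 'I_l -> {set V}) K :
  symmetric e -> (forall x y, e x y -> col y = ~~ col x) -> 0 < K ->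
  weld e A B -> (forall i, linked e col K (B i)) ->
  (forall i b, 2 * K <= #|[set x in B i | col x == b]|.+1) ->
  exists (c : V -> option 'I_l) nb J,
    [/\ welded e c col nb J K, #|J| = l & [set x | c x \in J] = A].
Proof.
move=> e_sym e_col K0 [[dB UB] _ mB] lB cB.
pose c x := [pick i | x \in B i].
pose nb (j : option 'I_l) x :=
  if j is Some i then odflt x [pick y in B i | e x y] else x.
pose J := [set j : option 'I_l | j != None].
have cE x i : (c x == Some i) = (x \in B i).
  rewrite /c; case: pickP => [k xk|->]; last by [].
  apply/eqP/idP => [[<-] //|xi]; congr Some; apply/eqP/negPn/negP => ki.
  by have := disjointFr (dB _ _ ki) xk; rewrite xi.
have pE i : [set x | c x == Some i] = B i by apply/setP=> x; rewrite inE cE.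
have nbP i k x : x \in B k -> k != i -> nb (Some i) x \in B i /\ e x (nb (Some i) x).
  move=> xk ki /=; case: pickP => [y /andP[] //|none].
  have /eqP := mB k i ki x xk; rewrite eqn_leq => /andP[_].
  by rewrite card_gt0 => /set0Pn[y]; rewrite inE none.
have cS x : c x \in J -> exists2 k, c x = Some k & x \in B k.
  by rewrite inE; case ck : (c x) => [k|] // _; exists k; rewrite // -cE ck.
exists c, nb, J; split.
- split=> //.
  + move=> [i|] x; rewrite inE // => _ /cS[k -> xk]; rewrite (inj_eq Some_inj) => ki.
    by apply/eqP; rewrite cE; have [] := nbP i k x xk ki.
  + move=> [i|] x; rewrite inE // => _ /cS[k -> xk]; rewrite (inj_eq Some_inj) => ki.
    by have [] := nbP i k x xk ki.
  + move=> [i|] x y; rewrite inE // => _ /cS[k xk xB] xy.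
    rewrite xk (inj_eq Some_inj) => ki nxy.
    have yB : y \in B k by rewrite -cE -xy xk.
    have [zi ex] := nbP i k x xB ki; have [_ ey] := nbP i k y yB ki.
    rewrite -nxy in ey; set z := nb _ x in zi ex ey.
    have /eqP/cards1P[w wE] := mB i k (ltac:(by rewrite eq_sym)) z zi.
    have xw : x \in [set w] by rewrite -wE inE xB e_sym.
    have yw : y \in [set w] by rewrite -wE inE yB e_sym.
    by move: xw yw; rewrite !inE => /eqP -> /eqP ->.
  + by move=> [i|]; rewrite inE // => _; rewrite pE.
  + by move=> [i|] b; rewrite inE // => _; rewrite pE.
- rewrite (_ : J = [set Some i | i in 'I_l]).
    by rewrite card_imset ?card_ord //; apply: Some_inj.
  apply/setP=> -[i|]; rewrite inE /=; apply/esym; first exact: imset_f.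
  by apply/imsetP => -[].
- rewrite -UB; apply/setP=> x; rewrite inE; apply/idP/bigcupP => [/cS[k _ xk]|[i _ xi]].
    by exists k.
  by rewrite inE; move: xi; rewrite -cE => /eqP ->.
Qed.

Section WeldingProcess.
Variables (V : finType) (e : rel V) (col : pred V).
Hypotheses (e_sym : symmetric e) (e_col : forall x y, e x y -> col y = ~~ col x).

Definition both_colours (A : {set V}) := forall b, 0 < #|[set x in A | col x == b]|.

Lemma edge_both_colours (A : {set V}) x y :
  x \in A -> y \in A -> e x y -> both_colours A.
Proof.
move=> xA yA exy b; apply/card_gt0P; have cy := e_col exy.
have [cx|cx] := eqVneq (col x) b; first by exists x; rewrite inE xA cx eqxx.
by exists y; rewrite inE yA cy; case: (col x) b cx => -[].
Qed.

Lemma ham_both_colours (A : {set V}) s t :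
  s != t -> has_hamiltonian_path e A s t -> both_colours A.
Proof.
move=> st [[|z q] [[/= pq lq _] qA]]; first by rewrite lq eqxx in st.
case/andP: pq => esz _.
by apply: (edge_both_colours _ _ esz); rewrite -qA !inE eqxx ?orbT.
Qed.

Lemma ham_pcover (A : {set V}) s t :
  has_hamiltonian_path e A s t -> pcover e A [:: (s, t)].
Proof. by case=> q [pq qA]; exists q; split=> //=; rewrite qA // /pcover setDv. Qed.

Lemma linked1 (A : {set V}) :
  (forall s t, s \in A -> t \in A -> col s -> ~~ col t -> pcover e A [:: (s, t)]) ->
  linked e col 1 A.
Proof.
move=> lA [//|[s t] [|? ?]] // _ _; rewrite demand_cons => /= /and5P[cs ct _ _ _].
by rewrite /ends_in /= andbT => /andP[sA tA]; apply: lA.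
Qed.

Lemma alternating_agree (f g : pred V) x p :
  path (fun u v => (f v == ~~ f u) && (g v == ~~ g u)) x p ->
  forall y, y \in x :: p -> f y (+) g y = f x (+) g x.
Proof.
elim: p x => [|z p IH] x /=; first by move=> _ y; rewrite inE => /eqP ->.
move=> /andP[/andP[/eqP fz /eqP gz] pz] y; rewrite inE => /predU1P[-> //|yp].
by rewrite (IH z pz y yp) fz gz addbN addNb negbK.
Qed.

Lemma alternating_count (f : pred V) x p :
  path (fun u v => f v == ~~ f u) x p -> ~~ odd (size (x :: p)) ->
  count f (x :: p) = count (predC f) (x :: p).
Proof.
elim: {p}_.+1 {-2}p x (ltnSn (size p)) => // n IH [|y [|z p]] x //=.
  by move=> _ /andP[/eqP -> _] _; case: (f x).
rewrite !ltnS => szp /and3P[/eqP fy _ pz]; rewrite !negbK => oz.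
have := IH p z (ltnW szp) pz; rewrite /= negbK => /(_ oz) ->.
by rewrite fy negbK addnCA.
Qed.

(** The partite sets witnessing laceability need not be induced by [col], but a
    Hamiltonian path shows that they are, up to exchange.  They are of equal size
    because that path has evenly many vertices, so that the balanced pairs are
    those with different colours. *)
Lemma even_laceable_linked (A : {set V}) :
  ~~ odd #|A| -> hamiltonian_laceable e A -> linked e col 1 A /\ both_colours A.
Proof.
move=> oA [U1 [U2 [[UA dU eU1 eU2] [s0 [t0 [s0A t0A st0 bal0]]] ham]]].
have ham0 := ham s0 t0 s0A t0A st0 bal0; split; last exact: ham_both_colours ham0.
have [q [[pq lq uq] qA]] := ham0.
have inU x : x \in A -> (x \in U2) = (x \notin U1).
  rewrite -UA in_setU; case: (boolP (x \in U1)) => [x1 _|_ /= -> //].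
  by rewrite (disjointFr dU x1).
have qinA x : x \in s0 :: q -> x \in A by rewrite -qA in_set.
have flip1 x y : x \in A -> y \in A -> e x y -> (y \in U1) = ~~ (x \in U1).
  move=> xA yA exy; have := @eU1 x y; have := @eU2 x y; rewrite !inU // exy.
  by case: (x \in U1); case: (y \in U1) => //= h1 h2; [have := h2 isT isT | have := h1 isT isT].
have pA : path (fun x y => [&& x \in A, y \in A & e x y]) s0 q.
  apply: (@sub_in_path _ (mem (s0 :: q)) e) pq; last exact/allP.
  by move=> x y xin yin exy; rewrite !qinA.
have alt := @alternating_agree (mem U1) col s0 q.
have {}alt y : y \in A -> (y \in U1) (+) col y = (s0 \in U1) (+) col s0.
  rewrite -qA in_set; apply: alt; apply: sub_path pA => u v /and3P[uA vA euv] /=.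
  by rewrite (flip1 u v) // (e_col euv) !eqxx.
have cardU (U : {set V}) : U \subset A -> count (mem U) (s0 :: q) = #|U|.
  move=> /subsetP UA'; rewrite -size_filter -(card_uniqP (filter_uniq _ uq)).
  apply: eq_card => x; rewrite mem_filter; apply: andb_idr => /UA'.
  by rewrite -qA in_set.
have U12 : #|U1| = #|U2|.
  rewrite -!cardU -?UA ?subsetUl ?subsetUr //.
  rewrite (alternating_count (f := mem U1)).
  - by apply: eq_in_count => x xq /=; rewrite inU ?qinA.
  - by apply: sub_path pA => u v /and3P[uA vA euv] /=; rewrite (flip1 u v).
  - by move: oA; rewrite -qA cardsE (card_uniqP uq).
apply: linked1 => s t sA tA cs ct; apply/ham_pcover/ham => //.
  by apply: contraNneq ct => <-.
rewrite /balanced_pair U12 GRing.subrr GRing.mulr0.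
have := alt s sA; rewrite -(alt t tA) cs (negbTE ct) addbF addbT => st1.
have sI (U : {set V}) x y : x \in U -> y \notin U -> [set x; y] :&: U = [set x].
  move=> xU yU; apply/setP=> z; rewrite !inE.
  have [->|_] := eqVneq z x; first by rewrite xU.
  by have [->|_] := eqVneq z y; rewrite //= (negbTE yU).
have s2 := inU s sA; have t2 := inU t tA; rewrite -st1 negbK in t2.
case s1 : (s \in U1) st1 s2 t2 => /= t1 s2 t2.
  have -> : [set s; t] :&: U1 = [set s] by apply: sI; rewrite -?t1.
  have -> : [set s; t] :&: U2 = [set t] by rewrite setUC; apply: sI; rewrite ?t2 ?s2.
  by rewrite !cards1 GRing.subrr.
have -> : [set s; t] :&: U1 = [set t] by rewrite setUC; apply: sI; rewrite -?t1 ?s1.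
have -> : [set s; t] :&: U2 = [set s] by apply: sI; rewrite ?t2 ?s2.
by rewrite !cards1 GRing.subrr.
Qed.

Lemma even_rank1_linked (A : {set V}) :
  ~~ odd #|A| -> hamiltonian_connected e A \/ hamiltonian_laceable e A ->
  linked e col 1 A /\ both_colours A.
Proof.
move=> oA [[A0 ham]|]; last exact: even_laceable_linked.
split.
  apply: linked1 => s t sA tA cs ct; apply/ham_pcover/ham => //.
  by apply: contraNneq ct => <-.
have [x xA] := set0Pn _ A0.
have /card_gt0P[y] : 0 < #|A :\ x| by move: oA; rewrite (cardsD1 x) xA; case: #|_|.
rewrite !inE => /andP[yx yA].
by apply: (ham_both_colours _ (ham y x yA xA yx)).
Qed.

(** There are just two single vertices, as three of them would form a triangle. *)
Lemma weld_singletons_linked (A : {set V}) l (B : 'I_l -> {set V}) :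
  1 < l -> weld e A B -> (forall i, #|B i| = 1) ->
  linked e col 1 A /\ both_colours A.
Proof.
move=> l2 [[dB UB] _ mB] B1.
have adj i j x y : i != j -> x \in B i -> y \in B j -> e x y.
  move=> ij xi yj; have /eqP/cards1P[z zE] := mB i j ij x xi.
  have : z \in [set z] by rewrite inE.
  rewrite -zE inE => /andP[zj exz].
  by have /eqP/cards1P[w wE] := B1 j; move: zj yj exz; rewrite wE !inE => /eqP -> /eqP ->.
have inA i x : x \in B i -> x \in A by move=> xi; rewrite -UB; apply/bigcupP; exists i.
have ex i : exists x, x \in B i by apply/card_gt0P; rewrite B1.
split; last first.
  have [x xi] := ex (Ordinal (ltnW l2)); have [y yi] := ex (Ordinal l2).
  by apply: (edge_both_colours (inA _ _ xi) (inA _ _ yi)); apply: adj xi yi.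
apply: linked1 => s t sA tA cs ct.
move: (sA) (tA); rewrite -{1 2}UB => /bigcupP[i _ si] /bigcupP[j _ tj].
have uB k x y : x \in B k -> y \in B k -> x = y.
  by have /eqP/cards1P[w ->] := B1 k; rewrite !inE => /eqP -> /eqP ->.
have st : s != t by apply: contraNneq ct => <-.
have ij : i != j by apply: contraNneq st => ij; apply/eqP/(uB j); rewrite // -ij.
have est := adj i j s t ij si tj.
have AE : A = [set:: [:: s; t]].
  apply/setP=> z; rewrite !inE; apply/idP/idP => [|/orP[] /eqP -> //].
  rewrite -UB => /bigcupP[k _ zk].
  have [ki|ki] := eqVneq i k; first by rewrite (uB k z s) ?eqxx // -ki.
  have [kj|kj] := eqVneq j k; first by rewrite (uB k z t) ?eqxx ?orbT // -kj.
  have := e_col (adj i k s z ki si zk); have := e_col (adj j k t z kj tj zk).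
  by rewrite cs (negbTE ct) => ->.
exists [:: t]; rewrite /pcover AE setDv subxx; split=> //.
by split; rewrite //= ?est // inE st.
Qed.

(** Rank 1 has to be kept apart: a single vertex meets no demand, and a weld of
    single vertices is where the induction starts. *)
Lemma process_linked n (A : {set V}) (w : welding_process e n A) :
  (forall C : {set V}, rank1_piece w C -> #|C| = 1 \/ ~~ odd #|C|) ->
  if n is m.+2 then
    linked e col m.+1 A /\ forall b, 2 * m.+1 <= #|[set x in A | col x == b]|.+1
  else #|A| = 1 \/ linked e col 1 A /\ both_colours A.
Proof.
elim: w => {n A} [A rk1|n A l B ll wAB ws IH] /= ev.
  have [|oA] := ev A erefl; [by left | right].
  exact: even_rank1_linked.
have {}IH i := IH i (fun C Ci => ev C (ex_intro _ i Ci)).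
have [_ szB _] := wAB.
case: n ll ws IH ev => [|n] ll ws IH _.
  pose i0 := Ordinal (ltnW ll : 0 < l).
  have [B1|[lB0 bB0]] := IH i0.
    have [] := weld_singletons_linked ll wAB (fun i => etrans (szB i i0) B1).
    by split=> // b; rewrite muln1 ltnS.
  have B1 : #|B i0| != 1.
    apply/eqP => /eqP/cards1P[x xE].
    have /card_gt0P[y] := bB0 true; have /card_gt0P[z] := bB0 false.
    by rewrite xE !inE => /andP[/eqP -> /eqP cx] /andP[/eqP ->]; rewrite cx.
  have lB i : linked e col 1 (B i) /\ both_colours (B i).
    by have [Bi|] := IH i; first by rewrite -(szB i) Bi in B1.
  have [|c [nb [J [W szJ UJ]]]] := weld_welded e_sym e_col (ltnSn 0) wAB (fun i => (lB i).1).
    by move=> i b; rewrite muln1 ltnS; apply: (lB i).2.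
  split=> [D D0 szD dD|b]; rewrite -UJ.
    by move=> eD; apply: (route W) => // j _; apply: leq_trans (count_size _ _) szD.
  have := weld_colour_card W b; rewrite szJ muln1 mul1n ltnS.
  exact: leq_trans (ltnW ll).
have [c [nb [J [W szJ UJ]]]] := weld_welded e_sym e_col (ltn0Sn n) wAB
  (fun i => (IH i).1) (fun i => (IH i).2).
split; first by rewrite -UJ; apply: (weld_links_more W); rewrite szJ.
move=> b; rewrite -UJ; have := weld_colour_card W b; rewrite szJ.
have : (2 * n.+1).-1 * n.+3 <= (2 * n.+1).-1 * l by rewrite leq_mul2l ll orbT.
set X := #|_|; move=> le1 le2; have := leq_trans le1 le2.
by clearbody X; clear; nia.
Qed.

End WeldingProcess.

Lemma pcover_paths (V I : finType) (e : rel V) (s t : I -> V) (A : {set V}) r :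
  uniq r -> pcover e A [seq (s i, t i) | i <- r] ->
  exists P : I -> seq V,
    [/\ forall i, i \in r -> path_between e (s i) (t i) (P i),
      {in r &, forall i j, i != j -> [disjoint [set:: s i :: P i] & [set:: s j :: P j]]}
      & forall x, x \in A <-> exists2 i, i \in r & x \in [set:: s i :: P i]].
Proof.
elim: r A => [|k r IH] A /=.
  by move=> _ ->; exists (fun _ => [::]); split=> // x; rewrite inE; split=> // -[].
case/andP=> kr /IH{}IH [q [/= pq qA /IH[P [pP dP AP]]]].
exists (fun i => if i == k then q else P i).
have rk i : i \in r -> (i == k) = false by move=> ir; apply: contraNF kr => /eqP <-.
have dk i : i \in r -> [disjoint [set:: s k :: q] & [set:: s i :: P i]].
  move=> ir; rewrite disjoint_sym disjoint_subset; apply/subsetP=> x xi.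
  have /AP : exists2 i, i \in r & x \in [set:: s i :: P i] by exists i.
  by rewrite !inE => /andP[].
split.
- by move=> i; rewrite inE => /predU1P[->|ir]; rewrite ?eqxx ?rk //; apply: pP.
- move=> i j; rewrite !inE => /predU1P[->|ir] /predU1P[->|jr]; rewrite ?eqxx ?rk //.
  + by rewrite dk.
  + by rewrite disjoint_sym dk.
  + exact: dP.
- move=> x; case xq : (x \in [set:: s k :: q]).
    rewrite (subsetP qA) //; split=> // _.
    by exists k; rewrite ?mem_head // eqxx.
  have -> : (x \in A) = (x \in A :\: [set:: s k :: q]) by rewrite in_setD xq.
  split=> [/AP[i ir xi]|[i + xi]].
    by exists i; rewrite ?rk // inE ir orbT.
  rewrite inE => /predU1P[ik|ir]; first by rewrite ik eqxx xq in xi.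
  by rewrite rk // in xi; apply/AP; exists i.
Qed.

Theorem theorem1p5 (n : nat) (V : finType) (e : rel V) (V1 V2 : {set V})
    (w : welding_process e n [set: V]) :
  2 <= n ->
  symmetric e ->
  irreflexive e ->
  bipartition e [set: V] V1 V2 ->
  (forall C : {set V}, rank1_piece w C -> #|C| = 1 \/ ~~ odd #|C|) ->
  forall s t : 'I_n.-1 -> V,
    injective s ->
    injective t ->
    (forall i, s i \in V1) ->
    (forall i, t i \in V2) ->
    has_pdpc e s t.
Proof.
move=> n2 e_sym _ [UV dV eV1 eV2] ev s t s_inj t_inj sV1 tV2.
have V12 x : (x \in V2) = (x \notin V1).
  have : x \in V1 :|: V2 by rewrite UV inE.
  rewrite in_setU; case: (boolP (x \in V1)) => [x1 _|_ /= -> //].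
  by rewrite (disjointFr dV x1).
have e_col x y : e x y -> (y \in V1) = ~~ (x \in V1).
  move=> exy; have := @eV1 x y; have := @eV2 x y; rewrite !V12 exy.
  by case: (x \in V1); case: (y \in V1) => //= h1 h2; [have := h2 isT isT | have := h1 isT isT].
case: n w n2 ev s t s_inj t_inj sV1 tV2 => [|[|m]] // w _ ev s t s_inj t_inj sV1 tV2.
have [lV _] := process_linked (col := mem V1) e_sym e_col ev.
pose D := [seq (s i, t i) | i <- enum 'I_m.+1].
have szD : size D = m.+1 by rewrite size_map size_enum_ord.
have /(pcover_paths (enum_uniq _))[P [pP dP AP]] : pcover e [set: V] D.
  apply: lV; rewrite ?szD // -?size_eq0 ?szD //.
    apply/and3P; split.
    - by apply/allP=> d /mapP[i _ ->] /=; rewrite sV1 -V12 tV2.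
    - by rewrite /unzip1 /D -map_comp map_inj_uniq ?enum_uniq // => i j /= /s_inj.
    - by rewrite /unzip2 /D -map_comp map_inj_uniq ?enum_uniq // => i j /= /t_inj.
  by apply/allP=> d _; rewrite !inE.
exists P; split=> [i|]; first by apply: pP; rewrite mem_enum.
split=> [i j ij|]; first by apply: dP; rewrite ?mem_enum.
apply/setP=> x; rewrite inE; apply/bigcupP.
have /AP[i _ xi] : x \in [set: V] by rewrite inE.
by exists i.
Qed.
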